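(* For all $(X,T)\in\mathbb{R}^2$ and $a,b\in\mathbb{C}$ with $ab\neq0$, $$\Psi(X,T;\mathbf{G}(a,b))=\mathrm{e}^{-\mathrm{i}\arg(ab)}\,\Psi\left(X,T;\mathbf{G}(\mathfrak{a},\mathfrak{b})\right),$$ where $$\mathfrak{a}:=\frac{|a|}{\sqrt{|a|^2+|b|^2}}\quad\text{and}\quad\mathfrak{b}:=\frac{|b|}{\sqrt{|a|^2+|b|^2}}$$ satisfy $\mathfrak{a},\mathfrak{b}>0$ with $\mathfrak{a}^2+\mathfrak{b}^2=1$.
   Context: Notation: $*$ is complex conjugation; $\sigma_3=\mathrm{diag}(1,-1)$; $\mathrm{e}^{f\sigma_3}=\mathrm{diag}(\mathrm{e}^{f},\mathrm{e}^{-f})$. For $(a,b)\in\mathbb{C}^2\setminus\{(0,0)\}$ let $$\mathbf{G}(a,b)=\frac{1}{\sqrt{|a|^2+|b|^2}}\begin{bmatrix}a & b^*\\ -b & a^*\end{bmatrix}.$$ For $(X,T)\in\mathbb{R}^2$ and $\mathbf{G}=\mathbf{G}(a,b)$, $\mathbf{P}(\Lambda;X,T,\mathbf{G})$ denotes the unique (it is known to exist) $2\times 2$ matrix function of $\Lambda$ such that: (i) it is analytic for $|\Lambda|\neq 1$ and takes continuous boundary values on the unit circle from the interior and from the exterior; (ii) writing $\mathbf{P}_+$ (resp. $\mathbf{P}_-$) for the boundary value on $|\Lambda|=1$ from the exterior (resp. interior), $$\mathbf{P}_+=\mathbf{P}_-\,\mathrm{e}^{-\mathrm{i}(\Lambda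 X+\Lambda^2T+2\Lambda^{-1})\sigma_3}\,\mathbf{G}\,\mathrm{e}^{\mathrm{i}(\Lambda X+\Lambda^2T+2\Lambda^{-1})\sigma_3},\quad |\Lambda|=1;$$ (iii) $\mathbf{P}\to\mathbb{I}$ as $\Lambda\to\infty$. Then $\Psi(X,T;\mathbf{G}):=2\mathrm{i}\lim_{\Lambda\to\infty}\Lambda P_{12}(\Lambda;X,T,\mathbf{G})$. *)

(* Defs.v *)
From Stdlib Require Import Reals ClassicalEpsilon.
From Coquelicot Require Import Coquelicot.
Open Scope C_scope.

Definition Cexp (z : C) : C :=
  (exp (Re z) * cos (Im z), exp (Re z) * sin (Im z))%R.

(* Principal branch, with values in (-PI, PI]; meaningful only for z <> 0. *)
Definition Carg (z : C) : R :=
  if Rle_dec 0 (Im z) then acos (Re z / Cmod z) else (- acos (Re z / Cmod z))%R.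

Definition mat2 := @matrix C 2 2.

(* Mmult for the ring structure of C. *)
Definition mul2 (A B : mat2) : mat2 := @Mmult C_Ring 2 2 2 A B.
Definition one2 : mat2 := @Mone C_Ring 2.

Definition entry (A : mat2) (i j : nat) : C := coeff_mat (0 : C) A i j.

Definition exp_sigma3 (f : C) : mat2 :=
  [[Cexp f, 0 : C], [0 : C, Cexp (- f)]].

Definition Gmat (a b : C) : mat2 :=
  let N : C := RtoC (sqrt (Cmod a ^ 2 + Cmod b ^ 2)) in
  [[a / N, Cconj b / N], [- b / N, Cconj a / N]].

(* The filter of neighbourhoods of the point at infinity of C. *)
Definition C_infty : (C -> Prop) -> Prop :=
  fun S => exists M : R, forall z : C, (M < Cmod z)%R -> S z.

Definition analytic_at (f : C -> C) (z0 : C) : Prop :=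
  exists (c : nat -> C) (r : R), (0 < r)%R /\
    forall z : C, (Cmod (z - z0) < r)%R ->
      @is_pseries C_AbsRing C_NormedModule c (z - z0) (f z).

(* Coquelicot has no topology on matrices: analyticity and limits of matrix
   functions are taken entrywise. *)
Definition mat2_analytic_on (D : C -> Prop) (P : C -> mat2) : Prop :=
  forall i j : nat, (i < 2)%nat -> (j < 2)%nat ->
    forall z : C, D z -> analytic_at (fun w => entry (P w) i j) z.

Definition mat2_lim (F : (C -> Prop) -> Prop) (P : C -> mat2) (L : mat2) : Prop :=
  forall i j : nat, (i < 2)%nat -> (j < 2)%nat ->
    filterlim (fun w => entry (P w) i j) F (locally (entry L i j)).

Definition on_circle (z : C) : Prop := Cmod z = 1%R.
Definition interior (z : C) : Prop := (Cmod z < 1)%R.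
Definition exterior (z : C) : Prop := (1 < Cmod z)%R.

(* [B] is a continuous function on the unit circle, and is the boundary value
   of [P] from the side [D]. *)
Definition boundary_value (D : C -> Prop) (P B : C -> mat2) : Prop :=
  forall z : C, on_circle z ->
    mat2_lim (within D (locally z)) P (B z) /\
    mat2_lim (within on_circle (locally z)) B (B z).

Definition phase (X T : R) (z : C) : C := z * X + z ^ 2 * T + 2 / z.

(* The values of [P] on the circle itself are irrelevant. *)
Definition rhp_solution (X T : R) (G : mat2) (P : C -> mat2) : Prop :=
  mat2_analytic_on (fun z => Cmod z <> 1%R) P /\
  (exists Pplus Pminus : C -> mat2,
     boundary_value exterior P Pplus /\
     boundary_value interior P Pminus /\
     forall z : C, on_circle z ->
       Pplus z =
         mul2 (mul2 (mul2 (Pminus z) (exp_sigma3 (- (Ci * phase X T z)))) G)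
              (exp_sigma3 (Ci * phase X T z))) /\
  mat2_lim C_infty P one2.

(* Some element satisfying [S] if there is one, and [d] otherwise. *)
Definition the {A : Type} (d : A) (S : A -> Prop) : A :=
  match excluded_middle_informative (exists x, S x) with
  | left H => proj1_sig (constructive_indefinite_description S H)
  | right _ => d
  end.

(* For G = Gmat a b with (a, b) <> (0, 0) the Riemann-Hilbert problem is known
   to have a solution, unique off the unit circle; the default value is the
   zero function. *)
Definition Psol (X T : R) (G : mat2) : C -> mat2 :=
  the (fun _ => [[0 : C, 0 : C], [0 : C, 0 : C]]) (rhp_solution X T G).

Definition lim_infty (f : C -> C) : C :=
  the (0 : C) (fun l : C => filterlim f C_infty (locally l)).

(* The entries of a matrix are numbered from 0: P_12 is [entry P 0 1]. *)
Definition Psi (X T : R) (G : mat2) : C :=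
  2 * Ci * lim_infty (fun z => z * entry (Psol X T G z) 0 1).

(* Main.v *)
Require Import Defs.
From Stdlib Require Import Reals.
From Coquelicot Require Import Coquelicot.
From Stdlib Require Import Lra Lia ClassicalEpsilon.
Open Scope C_scope.

(* Write alpha, beta for the phases of a, b.  Then G(a,b) is G(|a|,|b|)
   multiplied by diag(1/beta, 1/alpha) on the left and by
   D = diag(alpha beta, 1) on the right.  Diagonal matrices commute with the
   exponentials in the jump, so P -> D P D^-1 outside the circle and
   P -> D P diag(1/beta, 1/alpha) inside it carries solutions for G(a,b) to
   solutions for G(|a|,|b|), and multiplies P_12 by alpha beta near infinity.

   This identifies the chosen solutions because the problem has at most one.
   For two solutions P, Q the entries of P adj(Q) have no jump, so they are
   constant by the following form of the Liouville and Painleve theorems: a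
   function f that is analytic off the unit circle, continuous across it, and
   tends to L at infinity equals L.  Indeed h(z) = z (f(z) - f(z0)) / (z - z0)
   is again such a function, and its mean over |z| = r does not depend on r:
   the derivative in r vanishes for r <> 1 and the mean is continuous at
   r = 1.  The means tend to h(0) = 0 as r -> 0 and to L - f(z0) as
   r -> infinity.  Existence of solutions is not needed, since it transfers
   between the two matrices in both directions. *)

(** * Limits and strict derivatives in the complex plane *)

(** The balls of [C] are squares, as in a product of two lines; discs and squares are compared at
    the cost of a factor [sqrt 2]. *)
Lemma locally_Cmod (z : C) (P : C -> Prop) :
  locally z P <->
  exists d : R, (0 < d)%R /\ forall w : C, (Cmod (w - z) < d)%R -> P w.
Proof.
  split.
  - intros [d Hd]. exists d. split. apply cond_pos.
    intros w Hw. apply Hd. apply C_NormedModule_mixin_compat1. exact Hw.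
  - intros [d [Hd H]].
    assert (Hs : (0 < sqrt 2)%R) by (apply sqrt_lt_R0; lra).
    exists (mkposreal _ (Rdiv_lt_0_compat _ _ Hd Hs)).
    intros w Hw. apply H.
    apply (C_NormedModule_mixin_compat2 z w) in Hw. simpl in Hw.
    replace (sqrt 2 * (d / sqrt 2))%R with d in Hw by (field; lra). exact Hw.
Qed.

Lemma filterlim_Cmod {T : Type} (F : (T -> Prop) -> Prop) {FF : Filter F}
  (f : T -> C) (l : C) :
  filterlim f F (locally l) <->
  forall e : R, (0 < e)%R -> F (fun x => (Cmod (f x - l) < e)%R).
Proof.
  split.
  - intros H e He. apply (H (fun w => (Cmod (w - l) < e)%R)).
    apply locally_Cmod. exists e. auto.
  - intros H P HP. apply locally_Cmod in HP. destruct HP as [d [Hd HP]].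
    unfold filtermap. apply (filter_imp _ _ (fun x => HP (f x)) (H d Hd)).
Qed.

Section FilterAlgebra.
Context {T : Type} (F : (T -> Prop) -> Prop) {FF : Filter F}.

Lemma filterlim_Cplus (f g : T -> C) (l m : C) :
  filterlim f F (locally l) -> filterlim g F (locally m) ->
  filterlim (fun x => f x + g x) F (locally (l + m)).
Proof.
  intros Hf Hg.
  exact (filterlim_comp_2 _ _ _ Hf Hg (@filterlim_plus R_AbsRing C_R_NormedModule l m)).
Qed.

Lemma filterlim_Cmult (f g : T -> C) (l m : C) :
  filterlim f F (locally l) -> filterlim g F (locally m) ->
  filterlim (fun x => f x * g x) F (locally (l * m)).
Proof.
  intros Hf Hg.
  (* [filterlim_mult] speaks of the topology that [Cmod] induces on the ring [C], not of the product
     topology; [locally_C] identifies their neighbourhoods. *)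
  assert (Hc : forall h (k : C), filterlim h F (locally (T := C_UniformSpace) k) ->
            filterlim h F (locally (T := AbsRing_UniformSpace C_AbsRing) k)).
  { intros h k H P HP. apply H. apply locally_C. exact HP. }
  generalize (filterlim_comp_2 _ _ _ (Hc _ _ Hf) (Hc _ _ Hg) (@filterlim_mult C_AbsRing l m)).
  intros H P HP. apply H. apply locally_C. exact HP.
Qed.

Lemma filterlim_Copp (f : T -> C) (l : C) :
  filterlim f F (locally l) -> filterlim (fun x => - f x) F (locally (- l)).
Proof.
  intros Hf.
  exact (filterlim_comp _ _ _ f _ _ _ _ Hf (@filterlim_opp R_AbsRing C_R_NormedModule l)).
Qed.

Lemma filterlim_Cminus (f g : T -> C) (l m : C) :
  filterlim f F (locally l) -> filterlim g F (locally m) ->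
  filterlim (fun x => f x - g x) F (locally (l - m)).
Proof.
  intros Hf Hg. apply filterlim_Cplus. exact Hf. apply filterlim_Copp. exact Hg.
Qed.

Lemma filterlim_Cinv (f : T -> C) (l : C) :
  l <> 0 -> filterlim f F (locally l) ->
  filterlim (fun x => / f x) F (locally (/ l)).
Proof.
  intros Hl Hf. assert (Hl' := proj1 (Cmod_gt_0 l) Hl).
  apply filterlim_Cmod. exact FF. intros e He.
  (* The first bound keeps [f x] at distance more than [Cmod l / 2] from 0; given this, the second
     makes [Cmod (f x - l) / (Cmod (f x) * Cmod l)] smaller than [e]. *)
  pose (d := Rmin (Cmod l / 2) (e * Cmod l * Cmod l / 2)).
  assert (Hd : (0 < d)%R).
  { apply Rmin_case. lra. repeat apply Rmult_lt_0_compat; lra. }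
  generalize (proj1 (filterlim_Cmod F f l) Hf d Hd). apply filter_imp. intros x Hx.
  assert (H1 : (Cmod (f x - l) < Cmod l / 2)%R) by (apply Rlt_le_trans with (1 := Hx); apply Rmin_l).
  assert (H2 : (Cmod (f x - l) < e * Cmod l * Cmod l / 2)%R)
    by (apply Rlt_le_trans with (1 := Hx); apply Rmin_r).
  assert (H3 : (Cmod l / 2 < Cmod (f x))%R).
  { assert (H := Cmod_triangle (f x) (- (f x - l))).
    replace (f x + - (f x - l)) with l in H by ring. rewrite Cmod_opp in H. lra. }
  assert (Hfx : f x <> 0) by (apply Cmod_gt_0; lra).
  replace (/ f x - / l) with (- (f x - l) / (f x * l)) by (field; auto).
  rewrite Cmod_div by (apply Cmult_neq_0; auto). rewrite Cmod_opp, Cmod_mult.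
  apply Rmult_lt_reg_r with (Cmod (f x) * Cmod l)%R. apply Rmult_lt_0_compat; lra.
  unfold Rdiv. rewrite Rmult_assoc, Rinv_l, Rmult_1_r.
  2: apply Rmult_integral_contrapositive; split; lra.
  apply Rlt_le_trans with (1 := H2).
  replace (e * Cmod l * Cmod l / 2)%R with (e * Cmod l * (Cmod l / 2))%R by field.
  rewrite <- Rmult_assoc, (Rmult_comm (e * _)%R (Cmod l)), <- Rmult_assoc, (Rmult_comm (Cmod l) e).
  apply Rmult_le_compat_l. apply Rmult_le_pos; lra. lra.
Qed.

End FilterAlgebra.

(* Strict differentiability at a point, in Caratheodory form: the derivative is
   the limit of the slopes over pairs of points that both tend to z0. *)
Definition strict_derive (f : C -> C) (z0 l : C) : Prop :=
  exists phi : C * C -> C,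
    filterlim phi (filter_prod (locally z0) (locally z0)) (locally l) /\
    filter_prod (locally z0) (locally z0)
      (fun p => f (fst p) - f (snd p) = phi p * (fst p - snd p)).

Lemma strict_derive_ext_loc (f g : C -> C) (z0 l : C) :
  locally z0 (fun z => f z = g z) -> strict_derive f z0 l -> strict_derive g z0 l.
Proof.
  intros Hfg [phi [H1 H2]]. exists phi. split. exact H1.
  assert (H3 : filter_prod (locally z0) (locally z0) (fun p => f (fst p) = g (fst p))).
  { apply (filterlim_fst _ Hfg). }
  assert (H4 : filter_prod (locally z0) (locally z0) (fun p => f (snd p) = g (snd p))).
  { apply (filterlim_snd _ Hfg). }
  generalize (filter_and _ _ H2 (filter_and _ _ H3 H4)). apply filter_imp.
  intros p [E [E1 E2]]. now rewrite <- E1, <- E2.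
Qed.

Lemma strict_derive_continuous (f : C -> C) (z0 l : C) :
  strict_derive f z0 l -> filterlim f (locally z0) (locally (f z0)).
Proof.
  intros [phi [H1 H2]].
  assert (Hd : filterlim (fun z : C => (z, z0)) (locally z0)
                 (filter_prod (locally z0) (locally z0))).
  { apply filterlim_pair. apply filterlim_id.
    intros P HP. unfold filtermap. apply filter_forall. intros _. now apply locally_singleton. }
  assert (H3 : filterlim (fun z => phi (z, z0) * (z - z0) + f z0) (locally z0)
                 (locally (l * (z0 - z0) + f z0))).
  { apply filterlim_Cplus. apply _. 2: apply filterlim_const.
    apply filterlim_Cmult. apply _. apply (filterlim_comp _ _ _ _ phi _ _ _ Hd H1).
    apply filterlim_Cminus. apply _. apply filterlim_id. apply filterlim_const. }
  replace (l * (z0 - z0) + f z0) with (f z0) in H3 by ring.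
  refine (filterlim_ext_loc _ _ _ H3).
  refine (filter_imp (F := locally z0) _ _ _ (Hd _ H2)). intros z E. simpl in E. rewrite <- E. ring.
Qed.

Lemma strict_derive_const (c z0 : C) : strict_derive (fun _ => c) z0 0.
Proof.
  exists (fun _ => 0). split. apply filterlim_const.
  apply filter_forall. intros p. ring.
Qed.

Lemma strict_derive_id (z0 : C) : strict_derive (fun z => z) z0 1.
Proof.
  exists (fun _ => 1). split. apply filterlim_const.
  apply filter_forall. intros p. ring.
Qed.

Lemma strict_derive_plus (f g : C -> C) (z0 l m : C) :
  strict_derive f z0 l -> strict_derive g z0 m ->
  strict_derive (fun z => f z + g z) z0 (l + m).
Proof.
  intros [p [Hp1 Hp2]] [q [Hq1 Hq2]].
  exists (fun x => p x + q x). split. now apply filterlim_Cplus; try apply _.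
  generalize (filter_and _ _ Hp2 Hq2). apply filter_imp. intros x [E1 E2].
  rewrite Cmult_plus_distr_r, <- E1, <- E2. ring.
Qed.

Lemma strict_derive_mult (f g : C -> C) (z0 l m : C) :
  strict_derive f z0 l -> strict_derive g z0 m ->
  strict_derive (fun z => f z * g z) z0 (f z0 * m + g z0 * l).
Proof.
  intros Hf Hg.
  assert (Cf := strict_derive_continuous _ _ _ Hf).
  assert (Cg := strict_derive_continuous _ _ _ Hg).
  destruct Hf as [p [Hp1 Hp2]], Hg as [q [Hq1 Hq2]].
  (* From [f z g z - f w g w = f z (g z - g w) + g w (f z - f w)]. *)
  exists (fun x => f (fst x) * q x + g (snd x) * p x). split.
  - apply filterlim_Cplus; try apply _; apply filterlim_Cmult; try apply _; try assumption.
    + exact (filterlim_comp _ _ _ _ f _ _ _ filterlim_fst Cf).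
    + exact (filterlim_comp _ _ _ _ g _ _ _ filterlim_snd Cg).
  - generalize (filter_and _ _ Hp2 Hq2). apply filter_imp. intros [z w] [E1 E2]. simpl in *.
    rewrite Cmult_plus_distr_r, <- !Cmult_assoc, <- E1, <- E2. ring.
Qed.

Lemma strict_derive_Cinv_shift (a z0 : C) :
  z0 <> a -> strict_derive (fun z => / (z - a)) z0 (- / ((z0 - a) * (z0 - a))).
Proof.
  intros Ha.
  assert (Hz : z0 - a <> 0).
  { intros E. apply Ha. now apply Ceq_minus. }
  exists (fun p => - / ((fst p - a) * (snd p - a))). split.
  - apply filterlim_Copp. apply filterlim_Cinv; try apply _. now apply Cmult_neq_0.
    apply filterlim_Cmult; try apply _; apply filterlim_Cminus; try apply _;
      try apply filterlim_const. apply filterlim_fst. apply filterlim_snd.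
  - assert (H : locally z0 (fun z => z - a <> 0)).
    { apply locally_Cmod. exists (Cmod (z0 - a)). split. now apply Cmod_gt_0.
      intros w Hw E. replace (w - z0) with ((w - a) + - (z0 - a)) in Hw by ring.
      rewrite E, Cplus_0_l, Cmod_opp in Hw. lra. }
    assert (H1 : filter_prod (locally z0) (locally z0) (fun p => fst p - a <> 0)).
    { apply (filterlim_fst _ H). }
    assert (H2 : filter_prod (locally z0) (locally z0) (fun p => snd p - a <> 0)).
    { apply (filterlim_snd _ H). }
    generalize (filter_and _ _ H1 H2). apply filter_imp.
    intros [z w] [E1 E2]. simpl in *. field. auto.
Qed.

(** * Convergent power series *)

Lemma filterlim_Cmod_le {T : Type} (F : (T -> Prop) -> Prop) {FF : ProperFilter F}
  (f : T -> C) (l : C) (M : R) :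
  filterlim f F (locally l) -> F (fun x => (Cmod (f x) <= M)%R) -> (Cmod l <= M)%R.
Proof.
  intros Hf HM. apply Rnot_lt_le. intros Hl.
  assert (H := proj1 (filterlim_Cmod F f l) Hf (Cmod l - M)%R ltac:(lra)).
  destruct (filter_ex _ (filter_and _ _ H HM)) as [x [H1 H2]].
  assert (Ht := Cmod_triangle (f x) (- (f x - l))).
  replace (f x + - (f x - l)) with l in Ht by ring. rewrite Cmod_opp in Ht. lra.
Qed.

(** Induction on [x^(n+2) - y^(n+2) = x (x^(n+1) - y^(n+1)) + y^(n+1) (x - y)]. The crude factor
    [2^n] stands in for [n + 1], so that the sums built on it are geometric. *)
Lemma Cpow_diff_le (x y : C) (rho : R) (n : nat) :
  (Cmod x <= rho)%R -> (Cmod y <= rho)%R ->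
  (Cmod (x ^ S n - y ^ S n) <= (2 * rho) ^ n * Cmod (x - y))%R.
Proof.
  intros Hx Hy. assert (H0 := Cmod_ge_0 x). induction n as [|n IH].
  - simpl. rewrite !Cmult_1_r. lra.
  - replace (x ^ S (S n) - y ^ S (S n)) with (x * (x ^ S n - y ^ S n) + y ^ S n * (x - y))
      by (simpl; ring).
    eapply Rle_trans. apply Cmod_triangle. rewrite !Cmod_mult, Cmod_pow.
    assert (Hd := Cmod_ge_0 (x - y)).
    assert (H1 : (Cmod x * Cmod (x ^ S n - y ^ S n) <= rho * ((2 * rho) ^ n * Cmod (x - y)))%R).
    { apply Rmult_le_compat; try assumption. apply Cmod_ge_0. }
    assert (H2 : (Cmod y ^ S n <= rho * (2 * rho) ^ n)%R).
    { apply Rle_trans with (rho ^ S n)%R. apply pow_incr. split. apply Cmod_ge_0. assumption.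
      simpl. apply Rmult_le_compat_l. lra. apply pow_incr. lra. }
    assert (H3 := Rmult_le_compat_r _ _ _ Hd H2). simpl in *. lra.
Qed.

Lemma pow_n_Cpow (x : C) (n : nat) : @pow_n C_Ring x n = x ^ n.
Proof. induction n as [|n IH]. reflexivity. simpl. rewrite IH. reflexivity. Qed.

(** A term is the difference of two consecutive partial sums, and from some index on these lie
    within 1 of [l]; hence the bound 2 on the tail. *)
Lemma is_pseries_bounded (c : nat -> C) (x l : C) :
  @is_pseries C_AbsRing C_NormedModule c x l ->
  exists B : R, forall n, (Cmod (c n) * Cmod x ^ n <= B)%R.
Proof.
  intros H.
  assert (Ht : forall n : nat, Cmod (x ^ n * c n) = (Cmod (c n) * Cmod x ^ n)%R).
  { intros n. rewrite Cmod_mult, Cmod_pow. ring. }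
  assert (H1 := proj1 (filterlim_Cmod eventually _ l) H 1%R Rlt_0_1).
  destruct H1 as [N HN].
  assert (Hpre : forall N, exists B : R, forall n, (n <= N)%nat -> (Cmod (c n) * Cmod x ^ n <= B)%R).
  { clear. induction N as [|N [B HB]].
    - exists (Cmod (c O) * Cmod x ^ O)%R. intros n Hn. replace n with O by lia. lra.
    - exists (Rmax B (Cmod (c (S N)) * Cmod x ^ S N)). intros n Hn.
      destruct (Nat.eq_dec n (S N)) as [->|Hne]. apply Rmax_r.
      eapply Rle_trans. apply HB. lia. apply Rmax_l. }
  destruct (Hpre N) as [B HB]. exists (Rmax B 2). intros n.
  destruct (Nat.le_gt_cases n N) as [Hn|Hn].
  - eapply Rle_trans. apply HB, Hn. apply Rmax_l.
  - eapply Rle_trans. 2: apply Rmax_r.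
    destruct n as [|n]. lia.
    assert (E1 := HN n ltac:(lia)). assert (E2 := HN (S n) ltac:(lia)).
    rewrite <- Ht. rewrite sum_Sn in E2.
    set (s := @sum_n C_AbelianMonoid (fun k => scal (pow_n x k) (c k)) n : C) in *.
    change (Cmod (s + @pow_n C_Ring x (S n) * c (S n) - l) < 1)%R in E2.
    rewrite pow_n_Cpow in E2.
    replace (x ^ S n * c (S n)) with ((s + x ^ S n * c (S n) - l) + - (s - l)) by ring.
    eapply Rle_trans. apply Cmod_triangle. rewrite Cmod_opp. change (Cmod (s - l) < 1)%R in E1. lra.
Qed.

Definition partial_pseries (c : nat -> C) (N : nat) (x : C) : C :=
  @sum_n C_AbelianMonoid (fun k => x ^ k * c k) N.

Lemma partial_pseries_S (c : nat -> C) (N : nat) (x : C) :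
  partial_pseries c (S N) x = partial_pseries c N x + x ^ S N * c (S N).
Proof. exact (@sum_Sn C_AbelianMonoid _ _). Qed.

(** The term of degree [N + 2] adds at most [2 rho B / s^2 |x - y| (1/2)^N], and [2 - 2 (1/2)^N] is
    the sum of the powers of 1/2 with exponents below [N]. The remaining factor [rho] makes the
    slopes converge as the disc shrinks. *)
Lemma partial_pseries_diff_le (c : nat -> C) (s rho B : R) (x y : C) (N : nat) :
  (0 < s)%R -> (2 * rho <= s / 2)%R -> (Cmod x <= rho)%R -> (Cmod y <= rho)%R ->
  (forall n, (Cmod (c n) * s ^ n <= B)%R) ->
  (Cmod (partial_pseries c (S N) x - partial_pseries c (S N) y
     - c 1%nat * (x - y)) <= 2 * rho * B / s ^ 2 * Cmod (x - y) * (2 - 2 * (1 / 2) ^ N))%R.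
Proof.
  intros Hs Hrho Hx Hy HB. assert (H0 := Cmod_ge_0 x). induction N as [|N IH].
  - rewrite !partial_pseries_S. unfold partial_pseries. rewrite !sum_O.
    replace (_ - _ - _) with (0 : C) by (simpl; ring). rewrite Cmod_0. simpl. lra.
  - rewrite (partial_pseries_S c (S N) x), (partial_pseries_S c (S N) y).
    set (a := partial_pseries c (S N) x) in *.
    set (b := partial_pseries c (S N) y) in *.
    replace (_ - _ - _) with ((a - b - c 1%nat * (x - y)) + c (S (S N)) * (x ^ S (S N) - y ^ S (S N)))
      by ring.
    eapply Rle_trans. apply Cmod_triangle.
    assert (Hc := Cpow_diff_le x y rho (S N) Hx Hy).
    assert (Hd := Cmod_ge_0 (x - y)). assert (Hcc := Cmod_ge_0 (c (S (S N)))).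
    assert (H : (Cmod (c (S (S N)) * (x ^ S (S N) - y ^ S (S N)))
        <= 2 * rho * B / s ^ 2 * Cmod (x - y) * (1 / 2) ^ N)%R).
    { rewrite Cmod_mult. eapply Rle_trans. apply Rmult_le_compat_l. exact Hcc. exact Hc.
      assert (Hp : ((2 * rho) ^ S N <= 2 * rho * (s / 2) ^ N)%R).
      { simpl. apply Rmult_le_compat_l. lra. apply pow_incr. lra. }
      assert (Hb := HB (S (S N))).
      assert (Hb' : (Cmod (c (S (S N))) * (s / 2) ^ N <= B / s ^ 2 * (1 / 2) ^ N)%R).
      { replace (s / 2)%R with (s * (1 / 2))%R by field. rewrite Rpow_mult_distr.
        rewrite <- Rmult_assoc. apply Rmult_le_compat_r. apply pow_le; lra.
        apply Rmult_le_reg_r with (s ^ 2)%R. apply pow_lt; lra.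
        replace (B / s ^ 2 * s ^ 2)%R with B by (field; lra).
        simpl in Hb |- *. lra. }
      assert (E1 := Rmult_le_compat_l _ _ _ Hcc (Rmult_le_compat_r _ _ _ Hd Hp)).
      assert (E2 := Rmult_le_compat_l (2 * rho * Cmod (x - y))%R _ _
         ltac:(apply Rmult_le_pos; lra) Hb').
      lra. }
    change ((1 / 2) ^ S N)%R with (1 / 2 * (1 / 2) ^ N)%R. lra.
Qed.

(** Letting [N] tend to infinity in [partial_pseries_diff_le], the slopes over pairs in the disc of
    radius [rho] about [z0] differ from [c 1] by at most [4 rho B / s^2]. *)
Lemma analytic_at_strict_derive (f : C -> C) (z0 : C) :
  analytic_at f z0 -> exists l, strict_derive f z0 l.
Proof.
  intros [c [r [Hr Hf]]]. exists (c 1%nat).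
  (* Convergence at distance [r / 2] from the centre bounds the coefficients geometrically. *)
  assert (Hs : exists B : R, forall n, (Cmod (c n) * (r / 2) ^ n <= B)%R).
  { destruct (is_pseries_bounded c (RtoC (r / 2)) (f (z0 + RtoC (r / 2)))) as [B HB].
    - replace (RtoC (r / 2)) with ((z0 + RtoC (r / 2)) - z0) at 1 by ring. apply Hf.
      replace (z0 + RtoC (r / 2) - z0) with (RtoC (r / 2)) by ring.
      rewrite Cmod_R, Rabs_pos_eq; lra.
    - exists B. intros n. specialize (HB n). rewrite Cmod_R, Rabs_pos_eq in HB; lra. }
  destruct Hs as [B HB].
  assert (HB0 : (0 <= B)%R).
  { specialize (HB O). simpl in HB. assert (H := Cmod_ge_0 (c O)). lra. }
  set (s := (r / 2)%R) in *. assert (Hs : (0 < s)%R) by (unfold s; lra).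
  assert (Key : forall rho, (2 * rho <= s / 2)%R -> forall z w : C, (Cmod (z - z0) <= rho)%R ->
    (Cmod (w - z0) <= rho)%R ->
    (Cmod (f z - f w - c 1%nat * (z - w)) <= 4 * rho * B / s ^ 2 * Cmod (z - w))%R).
  { intros rho Hrho z w Hz Hw. assert (Hz0 := Cmod_ge_0 (z - z0)).
    assert (Lim : forall u, (Cmod (u - z0) <= rho)%R ->
      filterlim (fun N => partial_pseries c (S N) (u - z0)) eventually (locally (f u))).
    { intros u Hu. assert (H := Hf u ltac:(unfold s in *; lra)).
      apply filterlim_comp with (f := S) (g := fun N => partial_pseries c N (u - z0))
        (G := eventually).
      - apply eventually_subseq. intros n. lia.
      - revert H. apply filterlim_ext. intros N. apply sum_n_ext. intros n.
        now rewrite pow_n_Cpow. }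
    apply filterlim_Cmod_le with (F := eventually)
      (f := fun N => partial_pseries c (S N) (z - z0)
       - partial_pseries c (S N) (w - z0) - c 1%nat * (z - w)).
    - apply _.
    - apply filterlim_Cminus; try apply _. apply filterlim_Cminus; try apply _; now apply Lim.
      apply filterlim_const.
    - apply filter_forall. intros N.
      assert (H := partial_pseries_diff_le c s rho B (z - z0) (w - z0) N Hs Hrho Hz Hw HB).
      replace (z - z0 - (w - z0)) with (z - w) in H by ring.
      eapply Rle_trans. exact H.
      assert (P : (0 <= (1 / 2) ^ N)%R) by (apply pow_le; lra).
      assert (Q : (0 <= 2 * rho * B / s ^ 2 * Cmod (z - w))%R).
      { apply Rmult_le_pos. 2: apply Cmod_ge_0. apply Rdiv_le_0_compat.
        apply Rmult_le_pos; lra. apply pow_lt; lra. }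
      assert (Q' := Rmult_le_pos _ _ Q P). lra. }
  exists (fun p => if Ceq_dec (fst p) (snd p) then c 1%nat
                   else (f (fst p) - f (snd p)) / (fst p - snd p)).
  split.
  - apply filterlim_Cmod. apply _. intros e He.
    (* The first bound is the condition [2 rho <= s / 2] of [Key]; the second gives
       [4 rho B / s^2 < e], with [B + 1] in the denominator because [B] may be 0. *)
    set (rho := Rmin (s / 4) (e * s ^ 2 / (8 * (B + 1)))).
    assert (Hs2 : (0 < s ^ 2)%R) by (apply pow_lt; lra).
    assert (Hrho : (0 < rho)%R).
    { apply Rmin_case. lra. apply Rdiv_lt_0_compat. apply Rmult_lt_0_compat; lra. lra. }
    assert (L : locally z0 (fun z : C => (Cmod (z - z0) <= rho)%R)).
    { apply locally_Cmod. exists rho. split. exact Hrho. intros w Hw. lra. }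
    apply Filter_prod with (1 := L) (2 := L). intros z w Hz Hw. simpl.
    destruct (Ceq_dec z w) as [E|E].
    + replace (c 1%nat - c 1%nat) with (0 : C) by ring. rewrite Cmod_0. exact He.
    + assert (Hzw : z - w <> 0) by (intros E'; apply E; now apply Ceq_minus).
      replace ((f z - f w) / (z - w) - c 1%nat) with ((f z - f w - c 1%nat * (z - w)) / (z - w))
        by (field; exact Hzw).
      rewrite Cmod_div by exact Hzw. assert (Hp := proj1 (Cmod_gt_0 _) Hzw).
      assert (K := Key rho ltac:(assert (H := Rmin_l (s / 4) (e * s ^ 2 / (8 * (B + 1)))); fold rho in H; lra) z w Hz Hw).
      apply Rle_lt_trans with (4 * rho * B / s ^ 2)%R.
      * apply Rmult_le_reg_r with (Cmod (z - w)). exact Hp.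
        unfold Rdiv at 1. rewrite Rmult_assoc, Rinv_l, Rmult_1_r by lra. exact K.
      * assert (H := Rmin_r (s / 4) (e * s ^ 2 / (8 * (B + 1)))). fold rho in H.
        apply Rmult_lt_reg_r with (s ^ 2)%R. exact Hs2.
        replace (4 * rho * B / s ^ 2 * s ^ 2)%R with (4 * rho * B)%R by (field; lra).
        assert (H' := Rmult_le_compat_r (8 * (B + 1))%R _ _ ltac:(lra) H).
        replace (e * s ^ 2 / (8 * (B + 1)) * (8 * (B + 1)))%R with (e * s ^ 2)%R in H' by (field; lra).
        assert (0 <= rho * B)%R by (apply Rmult_le_pos; lra).
        assert (0 < e * s ^ 2)%R by (apply Rmult_lt_0_compat; lra).
        lra.
  - apply filter_forall. intros [z w]. simpl. destruct (Ceq_dec z w) as [->|E]. ring.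
    field. intros E'; apply E; now apply Ceq_minus.
Qed.

(** The difference quotient has the power series of [f] with its coefficients shifted by one. This
    makes its singularity at [z0] removable. *)
Lemma analytic_at_slope (f : C -> C) (z0 : C) :
  analytic_at f z0 ->
  exists g, analytic_at g z0 /\ locally z0 (fun z => f z = f z0 + (z - z0) * g z).
Proof.
  intros [c [r [Hr Hf]]].
  assert (E0 : f z0 = c O).
  { assert (H := Hf z0). replace (z0 - z0) with (0 : C) in H by ring. rewrite Cmod_0 in H.
    apply (filterlim_locally_unique (K := C_AbsRing) (V := C_NormedModule) _ _ _ (H Hr)).
    apply (@is_pseries_0 C_AbsRing C_NormedModule c). }
  exists (fun z => if Ceq_dec z z0 then c 1%nat else (f z - f z0) / (z - z0)).
  split.
  - exists (fun n => c (S n)), r. split. exact Hr. intros z Hz.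
    destruct (Ceq_dec z z0) as [->|E].
    + replace (z0 - z0) with (0 : C) by ring.
      apply (@is_pseries_0 C_AbsRing C_NormedModule (fun n => c (S n))).
    + assert (Hzw : z - z0 <> 0) by (intros E'; apply E; now apply Ceq_minus).
      assert (H := @is_pseries_decr_1 C_AbsRing C_NormedModule c (z - z0) (/ (z - z0)) _
         (Cinv_l _ Hzw) (Hf z Hz)).
      replace ((f z - f z0) / (z - z0)) with (/ (z - z0) * (f z + - c O)).
      exact H. rewrite E0. field. exact Hzw.
  - apply filter_forall. intros z. destruct (Ceq_dec z z0) as [->|E]. ring.
    field. intros E'; apply E; now apply Ceq_minus.
Qed.

(** * Strict derivatives along real curves *)

Lemma nonzero_null_sequence :
  exists h : nat -> C, (forall n, h n <> 0) /\ filterlim h eventually (locally (0 : C)).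
Proof.
  assert (Hn : forall n, INR (S n) <> 0%R) by (intros n; apply not_0_INR; lia).
  exists (fun n => RtoC (/ INR (S n))). split.
  - intros n E. apply RtoC_inj in E. now apply (Rinv_neq_0_compat _ (Hn n)).
  - apply filterlim_Cmod. apply _. intros e He.
    destruct (archimed_cor1 e He) as [N [HN HN0]]. exists N. intros n Hn'.
    replace (RtoC (/ INR (S n)) - 0) with (RtoC (/ INR (S n))) by ring.
    rewrite Cmod_R, Rabs_pos_eq.
    2: apply Rlt_le, Rinv_0_lt_compat, lt_0_INR; lia.
    apply Rle_lt_trans with (2 := HN). apply Rinv_le_contravar.
    now apply lt_0_INR. apply le_INR. lia.
Qed.

Lemma filterlim_Cplus_null {T : Type} (F : (T -> Prop) -> Prop) {FF : Filter F} (h : T -> C) (z : C) :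
  filterlim h F (locally (0 : C)) -> filterlim (fun n => z + h n) F (locally z).
Proof.
  intros H. assert (H' := filterlim_Cplus F _ _ _ _ (filterlim_const (F := F) z) H).
  now replace (z + 0) with z in H' by ring.
Qed.

Lemma strict_derive_seq (f : C -> C) (z l : C) (h : nat -> C) :
  strict_derive f z l -> (forall n, h n <> 0) -> filterlim h eventually (locally (0 : C)) ->
  filterlim (fun n => (f (z + h n) - f z) / h n) eventually (locally l).
Proof.
  intros [phi [H1 H2]] Hn Hh.
  assert (Hd : filterlim (fun n : nat => (z + h n, z)) eventually
                 (filter_prod (locally z) (locally z))).
  { apply filterlim_pair.
    - apply filterlim_Cplus_null. apply _. exact Hh.
    - apply filterlim_const. }
  refine (filterlim_ext_loc _ _ _ (filterlim_comp _ _ _ _ phi _ _ _ Hd H1)).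
  refine (filter_imp (F := eventually) _ _ _ (Hd _ H2)). intros n E. simpl in E.
  rewrite E. replace (z + h n - z) with (h n) by ring. field. apply Hn.
Qed.

(** All slopes of [f] over pairs close to [z0] are within [e / 2] of [d z0], and for [z1] close to
    [z0] the derivative [d z1] is a limit of such slopes. *)
Lemma strict_derive_derive_continuous (f d : C -> C) (z0 : C) :
  locally z0 (fun z => strict_derive f z (d z)) ->
  filterlim d (locally z0) (locally (d z0)).
Proof.
  intros Hd. destruct (locally_singleton _ _ Hd) as [phi [H1 H2]].
  destruct nonzero_null_sequence as [h [Hn Hh]].
  apply filterlim_Cmod. apply _. intros e He.
  assert (H3 := proj1 (filterlim_Cmod _ phi (d z0)) H1 (e / 2)%R ltac:(lra)).
  destruct (filter_and _ _ H2 H3) as [P Q HP HQ HPQ].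
  (* The pairs used are [(z1 + h n, z1)], so [z1] must lie in [Q] and have [P] as a
     neighbourhood. *)
  generalize (filter_and _ _ Hd (filter_and _ _ (locally_locally _ _ HP) HQ)).
  apply filter_imp. intros z1 [S1 [P1 Q1]].
  apply Rle_lt_trans with (e / 2)%R. 2: lra.
  assert (L := strict_derive_seq f z1 (d z1) h S1 Hn Hh).
  assert (L' := filterlim_Cminus eventually _ _ _ _ L (filterlim_const (F := eventually) (d z0))).
  apply (filterlim_Cmod_le _ _ _ _ L').
  refine (filter_imp (F := eventually) _ _ _ (filterlim_Cplus_null eventually h z1 Hh P P1)).
  intros n HP'. destruct (HPQ _ _ HP' Q1) as [E1 E2]. simpl in E1.
  rewrite E1. replace (z1 + h n - z1) with (h n) by ring.
  unfold Cdiv. rewrite <- Cmult_assoc, Cinv_r, Cmult_1_r by apply Hn.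
  now apply Rlt_le.
Qed.

Lemma is_derive_slope (f : R -> R) (x l : R) :
  is_derive f x l <->
  filterlim (fun y => (f y - f x) / (y - x))%R (locally' x) (locally l).
Proof.
  rewrite is_derive_Reals. split.
  - intros H P [e HP]. destruct (H e (cond_pos e)) as [d Hd].
    exists d. intros y Hy Hyx. change R in y. apply HP.
    assert (Hb : (Rabs (y - x) < d)%R) by exact Hy.
    specialize (Hd (y - x)%R ltac:(lra) Hb). replace (x + (y - x))%R with y in Hd by ring.
    exact Hd.
  - intros H e He. destruct (H _ (locally_ball l (mkposreal e He))) as [d Hd].
    exists d. intros h Hh Hhd.
    specialize (Hd (x + h)%R). replace (x + h - x)%R with h in Hd by ring. apply Hd.
    change (Rabs (x + h - x) < d)%R. now replace (x + h - x)%R with h by ring.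
    lra.
Qed.

Lemma filterlim_Cpair {T : Type} (F : (T -> Prop) -> Prop) {FF : Filter F}
  (f g : T -> R) (a b : R) :
  filterlim f F (locally a) -> filterlim g F (locally b) ->
  filterlim (fun x => (f x, g x) : C) F (locally ((a, b) : C)).
Proof.
  intros Hf Hg P [e HP].
  assert (Hf' : F (fun x => ball a e (f x))) by apply (Hf _ (locally_ball a e)).
  assert (Hg' : F (fun x => ball b e (g x))) by apply (Hg _ (locally_ball b e)).
  unfold filtermap. refine (filter_imp _ _ _ (filter_and _ _ Hf' Hg')).
  intros x [H1 H2]. apply HP. now split.
Qed.

Lemma filterlim_Re {T : Type} (F : (T -> Prop) -> Prop) {FF : Filter F} (f : T -> C) (l : C) :
  filterlim f F (locally l) -> filterlim (fun x => Re (f x)) F (locally (Re l)).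
Proof. intros H. apply (filterlim_comp _ _ _ f Re _ _ _ H). apply continuous_fst. Qed.

Lemma filterlim_Im {T : Type} (F : (T -> Prop) -> Prop) {FF : Filter F} (f : T -> C) (l : C) :
  filterlim f F (locally l) -> filterlim (fun x => Im (f x)) F (locally (Im l)).
Proof. intros H. apply (filterlim_comp _ _ _ f Im _ _ _ H). apply continuous_snd. Qed.

(** The chain rule: the slope of the composite is [phi] at two points of the curve times the slope
    of the curve. Real and imaginary parts are separated so that real calculus applies to them. *)
Lemma strict_derive_along_curve (f : C -> C) (u v : R -> R) (t a b : R) (l : C) :
  is_derive u t a -> is_derive v t b -> strict_derive f (u t, v t) l ->
  is_derive (fun s => Re (f (u s, v s))) t (Re (l * (a, b))) /\
  is_derive (fun s => Im (f (u s, v s))) t (Im (l * (a, b))).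
Proof.
  intros Hu Hv [phi [H1 H2]].
  assert (Cu : filterlim u (locally' t) (locally (u t))).
  { eapply filterlim_filter_le_1. 2: apply (ex_derive_continuous u t); now exists a.
    apply filter_le_within. }
  assert (Cv : filterlim v (locally' t) (locally (v t))).
  { eapply filterlim_filter_le_1. 2: apply (ex_derive_continuous v t); now exists b.
    apply filter_le_within. }
  apply is_derive_slope in Hu. apply is_derive_slope in Hv.
  assert (Hg : filterlim (fun s => ((u s, v s) : C, (u t, v t) : C)) (locally' t)
                 (filter_prod (locally ((u t, v t) : C)) (locally ((u t, v t) : C)))).
  { apply filterlim_pair. apply filterlim_Cpair; try apply _; assumption. apply filterlim_const. }
  assert (Hs : filterlim (fun s => (f (u s, v s) - f (u t, v t)) * RtoC (/ (s - t))%R)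
                 (locally' t) (locally (l * (a, b)))).
  { refine (filterlim_ext_loc _ _ _ (filterlim_Cmult _ _ _ _ _
      (filterlim_comp _ _ _ _ phi _ _ _ Hg H1)
      (filterlim_Cpair _ _ _ _ _ Hu Hv))).
    refine (filter_imp (F := locally' t) _ _ _ (Hg _ H2)). intros s E.
    simpl fst in E. simpl snd in E. rewrite E. rewrite <- Cmult_assoc. f_equal.
    unfold Cmult, RtoC, Cminus, Cplus, Copp, Rdiv, Rminus; simpl. f_equal; ring. }
  split; apply is_derive_slope.
  - apply filterlim_Re in Hs. 2: apply _. revert Hs. apply filterlim_ext. intros s.
    unfold Cmult, RtoC, Cminus, Cplus, Copp, Rdiv, Rminus, Re, Im; simpl. ring.
  - apply filterlim_Im in Hs. 2: apply _. revert Hs. apply filterlim_ext. intros s.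
    unfold Cmult, RtoC, Cminus, Cplus, Copp, Rdiv, Rminus, Re, Im; simpl. ring.
Qed.

(** * Means over circles *)

Definition polar (r t : R) : C := (r * cos t, r * sin t)%R.

Lemma Cmod_polar (r t : R) : Cmod (polar r t) = Rabs r.
Proof.
  unfold Cmod, polar. simpl fst. simpl snd.
  replace ((r * cos t) ^ 2 + (r * sin t) ^ 2)%R with (r²)%R.
  apply sqrt_Rsqr_abs.
  assert (H := sin2_cos2 t). unfold Rsqr in *.
  replace ((r * cos t) ^ 2 + (r * sin t) ^ 2)%R
    with (r * r * (sin t * sin t + cos t * cos t))%R by ring. rewrite H. ring.
Qed.

Lemma continuity_2d_pt_cos2 (r t : R) : continuity_2d_pt (fun _ v => cos v) r t.
Proof.
  apply (continuity_1d_2d_pt_comp cos (fun _ v => v)).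
  apply continuity_cos. apply continuity_2d_pt_id2.
Qed.

Lemma continuity_2d_pt_sin2 (r t : R) : continuity_2d_pt (fun _ v => sin v) r t.
Proof.
  apply (continuity_1d_2d_pt_comp sin (fun _ v => v)).
  apply continuity_sin. apply continuity_2d_pt_id2.
Qed.

Lemma filterlim_polar (r t : R) :
  filterlim (fun p : R * R => polar (fst p) (snd p)) (locally (r, t)) (locally (polar r t)).
Proof.
  apply filterlim_Cpair. apply _.
  - apply (continuity_2d_pt_filterlim (fun u v => u * cos v)%R).
    apply continuity_2d_pt_mult. apply continuity_2d_pt_id1. apply continuity_2d_pt_cos2.
  - apply (continuity_2d_pt_filterlim (fun u v => u * sin v)%R).
    apply continuity_2d_pt_mult. apply continuity_2d_pt_id1. apply continuity_2d_pt_sin2.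
Qed.

Lemma continuity_2d_pt_polar_Re (h : C -> C) (r t : R) :
  filterlim h (locally (polar r t)) (locally (h (polar r t))) ->
  continuity_2d_pt (fun u v => Re (h (polar u v))) r t.
Proof.
  intros Hh. apply continuity_2d_pt_filterlim. apply filterlim_Re. apply _.
  apply (filterlim_comp _ _ _ (fun p : R * R => polar (fst p) (snd p)) h _ _ _ (filterlim_polar r t) Hh).
Qed.

Lemma continuity_2d_pt_continuous_2 (f : R -> R -> R) (r t : R) :
  continuity_2d_pt f r t -> continuous (f r) t.
Proof.
  intros H. apply continuity_pt_filterlim. apply continuity_pt_locally.
  intros e. destruct (H e) as [d Hd]. exists d. intros v Hv. apply Hd.
  rewrite Rminus_diag, Rabs_R0. apply cond_pos. exact Hv.
Qed.

Lemma continuity_RInt_param (f : R -> R -> R) (a b r : R) :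
  (a <= b)%R -> (forall u t, continuity_2d_pt f u t) ->
  continuity_pt (fun u => RInt (f u) a b) r.
Proof.
  intros Hab Hf.
  assert (Hex : forall u, ex_RInt (f u) a b).
  { intros u. apply (ex_RInt_continuous (V := R_CompleteNormedModule)). intros t _.
    now apply continuity_2d_pt_continuous_2. }
  apply continuity_pt_locally. intros e.
  (* The [+ 1] keeps the denominator positive when [a = b]. *)
  assert (He : (0 < e / (2 * (b - a + 1)))%R).
  { apply Rdiv_lt_0_compat. apply cond_pos. lra. }
  destruct (uniform_continuity_2d_1d' f a b r (fun x _ => Hf r x) (mkposreal _ He)) as [d Hd].
  exists d. intros u Hu. change (Rabs (u - r) < d)%R in Hu.
  assert (Hm : (RInt (f u) a b - RInt (f r) a b)%R = RInt (fun t => f u t - f r t)%R a b).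
  { symmetry. apply (RInt_minus (V := R_CompleteNormedModule)); apply Hex. }
  rewrite Hm.
  apply Rle_lt_trans with ((b - a) * (e / (2 * (b - a + 1))))%R.
  - apply abs_RInt_le_const. exact Hab.
    + apply (ex_RInt_minus (V := R_NormedModule)); apply Hex.
    + intros t Ht. apply Rlt_le. assert (Hdp := cond_pos d). apply Rabs_def2 in Hu.
      apply (Hd t r t u); try lra. rewrite Rminus_diag, Rabs_R0. apply cond_pos.
  - assert (Hp := cond_pos e).
    apply Rmult_lt_reg_r with (2 * (b - a + 1))%R. lra.
    replace ((b - a) * (e / (2 * (b - a + 1))) * (2 * (b - a + 1)))%R with ((b - a) * e)%R
      by (field; lra).
    assert (0 <= (b - a) * e)%R by (apply Rmult_le_pos; lra). lra.
Qed.

(** Differentiation under the integral sign gives the integrand [Re (h' e^(it))], which is also the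
    derivative in [t] of [Im h / r]; that function has the same value at [0] and at [2 * PI]. *)
Lemma circle_mean_derive (h d : C -> C) (r : R) :
  (0 < r)%R -> (forall z, filterlim h (locally z) (locally (h z))) ->
  locally r (fun u => forall t, strict_derive h (polar u t) (d (polar u t))) ->
  (forall t, filterlim d (locally (polar r t)) (locally (d (polar r t)))) ->
  is_derive (fun u => RInt (fun t => Re (h (polar u t))) 0 (2 * PI)) r 0.
Proof.
  intros Hr Hc Hs Hd.
  assert (Hdr : forall u t, strict_derive h (polar u t) (d (polar u t)) ->
     is_derive (fun u => Re (h (polar u t))) u (Re (d (polar u t) * polar 1 t))).
  { intros u t Hut.
    apply (strict_derive_along_curve h (fun u => u * cos t)%R (fun u => u * sin t)%R).
    auto_derive; [exact I|ring]. auto_derive; [exact I|ring]. exact Hut. }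
  (* The Cauchy-Riemann equations in polar form: [h (r e^(it))] has the derivative [h' i r e^(it)]
     in [t], whose imaginary part is [r Re (h' e^(it))]. *)
  assert (Hdt : forall t, is_derive (fun t => Im (h (polar r t)) / r)%R t
                   (Re (d (polar r t) * polar 1 t))).
  { intros t.
    destruct (strict_derive_along_curve h (fun t => r * cos t)%R (fun t => r * sin t)%R t
       (- r * sin t)%R (r * cos t)%R (d (polar r t))) as [_ H].
    auto_derive; [exact I|ring]. auto_derive; [exact I|ring]. exact (locally_singleton _ _ Hs t).
    apply (is_derive_scal _ _ (/ r)%R) in H.
    replace (Re _) with (/ r * Im (d (polar r t) * ((- r * sin t)%R, (r * cos t)%R)))%R
      by (unfold polar, Re, Im; simpl; field; lra).
    revert H. apply is_derive_ext. intros s. unfold Rdiv. apply Rmult_comm. }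
  assert (HD : locally r (fun u => forall t,
      Derive (fun u => Re (h (polar u t))) u = Re (d (polar u t) * polar 1 t))).
  { revert Hs. apply filter_imp. intros u Hu t. apply is_derive_unique. now apply Hdr. }
  assert (Hcont : forall t, continuity_2d_pt (fun u v => Re (d (polar u v) * polar 1 v)) r t).
  { intros t.
    apply continuity_2d_pt_filterlim. apply filterlim_Re. apply _.
    apply (filterlim_Cmult _ (fun p : R * R => d (polar (fst p) (snd p)))
      (fun p => polar 1 (snd p))).
    - apply (filterlim_comp _ _ _ (fun p : R * R => polar (fst p) (snd p)) d _ _ _
        (filterlim_polar r t) (Hd t)).
    - apply filterlim_Cpair. apply _.
      + apply (continuity_2d_pt_filterlim (fun _ v => 1 * cos v)%R).
        apply continuity_2d_pt_mult. apply continuity_2d_pt_const. apply continuity_2d_pt_cos2.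
      + apply (continuity_2d_pt_filterlim (fun _ v => 1 * sin v)%R).
        apply continuity_2d_pt_mult. apply continuity_2d_pt_const. apply continuity_2d_pt_sin2. }
  assert (Hz : RInt (fun t => Derive (fun u => Re (h (polar u t))) r) 0 (2 * PI) = 0%R).
  - apply locally_singleton in HD.
    rewrite (RInt_ext _ (Derive (fun t => Im (h (polar r t)) / r)%R)).
    + rewrite RInt_Derive.
      * unfold polar. rewrite cos_2PI, sin_2PI, cos_0, sin_0. lra.
      * intros t _. eexists. apply Hdt.
      * intros t _. apply continuous_ext with (f := fun t => Re (d (polar r t) * polar 1 t)).
        intros s. symmetry. apply is_derive_unique, Hdt.
        now apply (continuity_2d_pt_continuous_2 (fun u v => Re (d (polar u v) * polar 1 v))).
    + intros t _. rewrite HD. symmetry. apply is_derive_unique, Hdt.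
  - apply (fun H => eq_ind _ (is_derive (fun u => RInt (fun t => Re (h (polar u t))) 0 (2 * PI)) r) H _ Hz).
    apply (is_derive_RInt_param (fun u t => Re (h (polar u t))) 0 (2 * PI) r).
    + revert Hs. apply filter_imp. intros u Hu t _. eexists. now apply Hdr.
    + intros t _. apply continuity_2d_pt_ext_loc with (2 := Hcont t).
      destruct HD as [e He]. exists e. intros u v Hu _. symmetry. now apply He.
    + apply filter_forall. intros u.
      apply (ex_RInt_continuous (V := R_CompleteNormedModule)). intros t _.
      apply (continuity_2d_pt_continuous_2 (fun u v => Re (h (polar u v)))).
      now apply continuity_2d_pt_polar_Re.
Qed.

(** * Comparison of the value at 0 with the limit at infinity *)

Global Instance C_infty_filter : ProperFilter C_infty.
Proof.
  split.
  - intros P [M HM]. exists (RtoC (Rabs M + 1)). apply HM. rewrite Cmod_R.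
    assert (H := Rle_abs M). assert (H' := Rabs_pos M). rewrite Rabs_pos_eq; lra.
  - split.
    + now exists 0%R.
    + intros P Q [M HM] [N HN]. exists (Rmax M N). intros z Hz.
      assert (H1 := Rmax_l M N). assert (H2 := Rmax_r M N).
      split; [apply HM|apply HN]; lra.
    + intros P Q HPQ [M HM]. exists M. auto.
Qed.

Lemma value_at_0_Re_eq_limit (h : C -> C) (M : C) :
  (forall z, filterlim h (locally z) (locally (h z))) ->
  (forall z, Cmod z <> 1%R -> exists l, strict_derive h z l) ->
  filterlim h C_infty (locally M) -> Re (h 0) = Re M.
Proof.
  intros Hc Hs HM.
  (* Choice turns the pointwise derivatives into a function, continuous off the circle by
     [strict_derive_derive_continuous]. *)
  pose (d := fun z => epsilon (inhabits (0 : C)) (strict_derive h z)).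
  assert (Hd : forall z, Cmod z <> 1%R -> strict_derive h z (d z)).
  { intros z Hz. apply epsilon_spec. now apply Hs. }
  (* Left unnormalised: at radius 0 it equals [2 * PI * Re (h 0)]. *)
  pose (mean := fun r => RInt (fun t => Re (h (polar r t))) 0 (2 * PI)).
  assert (Hmc : forall r, continuity_pt mean r).
  { intros r. apply (continuity_RInt_param (fun r t => Re (h (polar r t)))).
    assert (H := PI_RGT_0); lra. intros u t. now apply continuity_2d_pt_polar_Re. }
  assert (Hnear : forall r : R, (0 < r)%R -> r <> 1%R ->
       locally r (fun u => forall t, Cmod (polar u t) <> 1%R)).
  { intros r Hr Hr1. assert (He : (0 < Rmin r (Rabs (r - 1)))%R).
    { apply Rmin_case. exact Hr. apply Rabs_pos_lt. lra. }
    exists (mkposreal _ He). intros u Hu t. change (Rabs (u - r) < Rmin r (Rabs (r - 1)))%R in Hu.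
    rewrite Cmod_polar. assert (H1 := Rmin_l r (Rabs (r - 1))). assert (H2 := Rmin_r r (Rabs (r - 1))).
    assert (Hu1 := Rlt_le_trans _ _ _ Hu H1). assert (Hu2 := Rlt_le_trans _ _ _ Hu H2).
    apply Rabs_def2 in Hu1. rewrite Rabs_pos_eq by lra. intros ->.
    rewrite (Rabs_minus_sym 1 r) in Hu2. lra. }
  assert (Hmd : forall r, (0 < r)%R -> r <> 1%R -> is_derive mean r 0).
  { intros r Hr Hr1. apply circle_mean_derive with d; try assumption.
    - generalize (Hnear r Hr Hr1). apply filter_imp. intros u Hu t. now apply Hd.
    - intros t. apply strict_derive_derive_continuous with h.
      apply locally_Cmod. exists (Rabs (r - 1)). split. apply Rabs_pos_lt; lra.
      intros w Hw. apply Hd. intros Hw1.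
      assert (T1 := Cmod_triangle (polar r t) (w - polar r t)).
      assert (T2 := Cmod_triangle w (- (w - polar r t))).
      replace (polar r t + (w - polar r t)) with w in T1 by ring.
      replace (w + - (w - polar r t)) with (polar r t) in T2 by ring.
      rewrite Cmod_opp in T2. rewrite Cmod_polar, Rabs_pos_eq in T1, T2 by lra.
      revert Hw. unfold Rabs. destruct (Rcase_abs (r - 1)); lra. }
  (* The mean value theorem asks for the derivative only inside the segment and for continuity up to
     its ends, so the radii 0 and 1 are allowed as endpoints. *)
  assert (Hseg : forall a b : R, (a < b)%R -> (forall r, (a < r < b)%R -> (0 < r)%R /\ r <> 1%R) ->
      mean a = mean b).
  { intros a b Hab Hr.
    destruct (MVT_gen mean a b (fun _ => 0%R)) as [c [_ E]].
    - rewrite Rmin_left, Rmax_right by lra. intros r Hr'. now apply Hmd; apply Hr.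
    - intros r _. apply Hmc.
    - lra. }
  assert (H01 : mean 0 = mean 1) by (apply Hseg; intros; lra).
  assert (H0 : mean 0 = (2 * PI * Re (h 0))%R).
  { unfold mean. rewrite (RInt_ext _ (fun _ => Re (h 0))).
    - rewrite RInt_const. change scal with Rmult. simpl. ring.
    - intros t _. unfold polar. now rewrite !Rmult_0_l. }
  assert (HPI := PI_RGT_0).
  apply cond_eq. intros e He.
  assert (HM' := proj1 (filterlim_Cmod C_infty h M) HM (e / 2)%R ltac:(lra)).
  destruct HM' as [K HK].
  (* A radius beyond both the unit circle and the threshold [K]. *)
  set (r := (Rmax K 1 + 1)%R).
  assert (Hr := Rmax_l K 1). assert (Hr' := Rmax_r K 1).
  assert (H1r : mean 1 = mean r) by (apply Hseg; intros; unfold r in *; lra).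
  assert (Hex : ex_RInt (fun t => Re (h (polar r t))) 0 (2 * PI)).
  { apply (ex_RInt_continuous (V := R_CompleteNormedModule)). intros t _.
    apply (continuity_2d_pt_continuous_2 (fun u v => Re (h (polar u v)))).
    now apply continuity_2d_pt_polar_Re. }
  assert (Hm : (mean r - 2 * PI * Re M)%R = RInt (fun t => Re (h (polar r t)) - Re M)%R 0 (2 * PI)).
  { rewrite (RInt_minus (V := R_CompleteNormedModule) _ (fun _ => Re M)).
    rewrite RInt_const. change scal with Rmult. change minus with Rminus. simpl. unfold mean. ring.
    exact Hex. apply (ex_RInt_const (V := R_NormedModule)). }
  assert (Hb : (Rabs (mean r - 2 * PI * Re M) <= (2 * PI - 0) * (e / 2))%R).
  { rewrite Hm. apply abs_RInt_le_const. lra.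
    - apply (ex_RInt_minus (V := R_NormedModule)). exact Hex. apply (ex_RInt_const (V := R_NormedModule)).
    - intros t _. apply Rlt_le. eapply Rle_lt_trans. 2: apply (HK (polar r t)).
      + replace (Re (h (polar r t)) - Re M)%R with (Re (h (polar r t) - M)) by (unfold Re, Cminus; simpl; ring).
        apply re_le_Cmod.
      + rewrite Cmod_polar, Rabs_pos_eq; unfold r; lra. }
  rewrite <- H1r, <- H01, H0 in Hb.
  replace (2 * PI * Re (h 0) - 2 * PI * Re M)%R with (2 * PI * (Re (h 0) - Re M))%R in Hb by ring.
  rewrite Rabs_mult, (Rabs_pos_eq (2 * PI)) in Hb by lra.
  apply Rmult_lt_reg_l with (2 * PI)%R. lra.
  assert (0 < PI * e)%R by (apply Rmult_lt_0_compat; lra). lra.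
Qed.

(** Since [Im w] is [Re (- Ci * w)], the statement on real parts is applied to [h] and to
    [- Ci * h]. *)
Lemma value_at_0_eq_limit (h : C -> C) (M : C) :
  (forall z, filterlim h (locally z) (locally (h z))) ->
  (forall z, Cmod z <> 1%R -> exists l, strict_derive h z l) ->
  filterlim h C_infty (locally M) -> h 0 = M.
Proof.
  intros Hc Hs HM.
  assert (H1 := value_at_0_Re_eq_limit h M Hc Hs HM).
  assert (H2 : Re (- Ci * h 0) = Re (- Ci * M)).
  { apply (value_at_0_Re_eq_limit (fun z => - Ci * h z)).
    - intros z. apply filterlim_Cmult; try apply _. apply filterlim_const. apply Hc.
    - intros z Hz. destruct (Hs z Hz) as [l Hl]. eexists.
      apply strict_derive_mult. apply strict_derive_const. exact Hl.
    - apply filterlim_Cmult; try apply _. apply filterlim_const. exact HM. }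
  destruct (h 0) as [x y], M as [x' y']. unfold Re, Ci in *. simpl in *.
  f_equal; lra.
Qed.

(** * A Liouville theorem across the circle *)

(* Analyticity weakened so that its stability under products is immediate: it
   only asks that the difference quotient at z0 be strictly differentiable. *)
Definition regular_at (f : C -> C) (z0 : C) : Prop :=
  exists g l, strict_derive g z0 l /\ locally z0 (fun z => f z = f z0 + (z - z0) * g z).

Lemma analytic_at_regular (f : C -> C) (z0 : C) : analytic_at f z0 -> regular_at f z0.
Proof.
  intros H. destruct (analytic_at_slope f z0 H) as [g [Hg E]].
  destruct (analytic_at_strict_derive g z0 Hg) as [l Hl]. now exists g, l.
Qed.

Lemma regular_at_strict_derive (f : C -> C) (z0 : C) :
  regular_at f z0 -> exists l, strict_derive f z0 l.
Proof.
  intros [g [l [Hg E]]]. eexists.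
  apply strict_derive_ext_loc with (fun z => f z0 + (z + - z0) * g z).
  - revert E. apply filter_imp. intros z E. now rewrite E.
  - apply strict_derive_plus. apply strict_derive_const.
    apply strict_derive_mult. 2: exact Hg.
    apply strict_derive_plus. apply strict_derive_id. apply strict_derive_const.
Qed.

Lemma regular_at_mult (f1 f2 : C -> C) (z0 : C) :
  regular_at f1 z0 -> regular_at f2 z0 -> regular_at (fun z => f1 z * f2 z) z0.
Proof.
  intros H1 [g2 [l2 [Hg2 E2]]]. destruct (regular_at_strict_derive f1 z0 H1) as [k1 Hk1].
  destruct H1 as [g1 [l1 [Hg1 E1]]].
  (* From [f1 z f2 z - f1 z0 f2 z0 = f1 z (f2 z - f2 z0) + f2 z0 (f1 z - f1 z0)]. *)
  exists (fun z => f1 z * g2 z + f2 z0 * g1 z). eexists. split.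
  - apply strict_derive_plus; apply strict_derive_mult; try eassumption.
    apply strict_derive_const.
  - generalize (filter_and _ _ E1 E2). apply filter_imp. intros z [F1 F2].
    rewrite F2.
    transitivity (f1 z * f2 z0 + (z - z0) * (f1 z * g2 z)). ring.
    rewrite F1 at 1. ring.
Qed.

Lemma regular_at_plus (f1 f2 : C -> C) (z0 : C) :
  regular_at f1 z0 -> regular_at f2 z0 -> regular_at (fun z => f1 z + f2 z) z0.
Proof.
  intros [g1 [l1 [Hg1 E1]]] [g2 [l2 [Hg2 E2]]].
  exists (fun z => g1 z + g2 z). eexists. split.
  - apply strict_derive_plus; eassumption.
  - generalize (filter_and _ _ E1 E2). apply filter_imp. intros z [F1 F2].
    rewrite F1, F2. ring.
Qed.

Lemma regular_at_const (c z0 : C) : regular_at (fun _ => c) z0.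
Proof.
  exists (fun _ => 0), 0. split. apply strict_derive_const.
  apply filter_forall. intros z. ring.
Qed.

Lemma locally_off_circle (z : C) : Cmod z <> 1%R -> locally z (fun w => Cmod w <> 1%R).
Proof.
  intros Hz. apply locally_Cmod. exists (Rabs (Cmod z - 1)).
  split. apply Rabs_pos_lt; lra.
  intros w Hw Hw1.
  assert (T1 := Cmod_triangle z (w - z)). assert (T2 := Cmod_triangle w (- (w - z))).
  replace (z + (w - z)) with w in T1 by ring.
  replace (w + - (w - z)) with z in T2 by ring. rewrite Cmod_opp in T2.
  revert Hw. unfold Rabs. destruct (Rcase_abs _); lra.
Qed.

Lemma locally_Cneq (z a : C) : z <> a -> locally z (fun w => w <> a).
Proof.
  intros Ha. apply locally_Cmod. exists (Cmod (a - z)). split.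
  - apply Cmod_gt_0. intros E. apply Ha. symmetry. now apply Ceq_minus.
  - intros w Hw ->. lra.
Qed.

Lemma filterlim_Cinv_shift_infty (a : C) :
  filterlim (fun z => / (z - a)) C_infty (locally (0 : C)).
Proof.
  apply filterlim_Cmod. apply _. intros e He. exists (Cmod a + / e)%R. intros z Hz.
  assert (T := Cmod_triangle (z - a) a). replace (z - a + a) with z in T by ring.
  assert (Hie := Rinv_0_lt_compat _ He).
  assert (H : (/ e < Cmod (z - a))%R) by lra.
  replace (/ (z - a) - 0) with (/ (z - a)) by ring.
  rewrite Cmod_inv. 2: apply Cmod_gt_0; lra.
  rewrite <- (Rinv_inv e). apply Rinv_lt_contravar. apply Rmult_lt_0_compat; lra. exact H.
Qed.

Lemma liouville_across_circle (f B : C -> C) (L : C) :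
  (forall z, Cmod z <> 1%R -> regular_at f z) ->
  (forall z, on_circle z ->
    filterlim f (within exterior (locally z)) (locally (B z)) /\
    filterlim f (within Defs.interior (locally z)) (locally (B z)) /\
    filterlim B (within on_circle (locally z)) (locally (B z))) ->
  filterlim f C_infty (locally L) ->
  forall z0, Cmod z0 <> 1%R -> f z0 = L.
Proof.
  intros Hr Hb HL z0 Hz0.
  (* The values of [f] on the circle are arbitrary; replacing them by the common boundary value [B]
     gives a function continuous everywhere. *)
  pose (F := fun z => if Req_dec_T (Cmod z) 1 then B z else f z).
  assert (HFf : forall z, Cmod z <> 1%R -> f z = F z).
  { intros z Hz. unfold F. now destruct (Req_dec_T (Cmod z) 1). }
  assert (HFs : forall z, Cmod z <> 1%R -> exists l, strict_derive F z l).
  { intros z Hz. destruct (regular_at_strict_derive f z (Hr z Hz)) as [l Hl]. exists l.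
    apply strict_derive_ext_loc with (2 := Hl).
    generalize (locally_off_circle z Hz). apply filter_imp. exact HFf. }
  assert (HFc : forall z, filterlim F (locally z) (locally (F z))).
  { intros z. destruct (Req_dec_T (Cmod z) 1) as [E|E].
    - destruct (Hb z E) as [H1 [H2 H3]].
      replace (F z) with (B z) by (unfold F; now destruct (Req_dec_T (Cmod z) 1)).
      (* A neighbourhood of a point of the circle splits into an exterior, an interior and a circle
         part, and each of the three limits handles one of them. *)
      intros P HP. unfold filtermap.
      specialize (H1 P HP). specialize (H2 P HP). specialize (H3 P HP).
      unfold filtermap, within in H1, H2, H3.
      refine (filter_imp (F := locally z) _ _ _ (filter_and _ _ H1 (filter_and _ _ H2 H3))).
      intros w [K1 [K2 K3]]. unfold F. destruct (Req_dec_T (Cmod w) 1) as [Ew|Ew].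
      now apply K3. destruct (Rtotal_order (Cmod w) 1) as [?|[?|?]].
      now apply K2. contradiction. now apply K1.
    - destruct (HFs z E) as [l Hl]. now apply strict_derive_continuous with l. }
  destruct (Hr z0 Hz0) as [g [l [Hg Eg]]].
  (* At [z0] the quotient is completed by [g z0], so that near [z0] it agrees with [g], which is
     strictly differentiable there. *)
  pose (h := fun z => z * (if Ceq_dec z z0 then g z0 else (F z - F z0) / (z - z0))).
  assert (Hh0 : locally z0 (fun z => z * g z = h z)).
  { generalize (filter_and _ _ (locally_off_circle z0 Hz0) Eg). apply filter_imp.
    intros z [H1 H2]. unfold h. destruct (Ceq_dec z z0) as [->|E]. reflexivity.
    rewrite <- !HFf by assumption. rewrite H2. field.
    intros E'; apply E; now apply Ceq_minus. }
  assert (Hh1 : forall z, z <> z0 -> locally z (fun w => w * ((F w + - F z0) * / (w - z0)) = h w)).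
  { intros z Hz. generalize (locally_Cneq z z0 Hz). apply filter_imp. intros w Hw.
    unfold h. now destruct (Ceq_dec w z0). }
  assert (Hhs : forall z, Cmod z <> 1%R -> exists l, strict_derive h z l).
  { intros z Hz. destruct (Ceq_dec z z0) as [->|E].
    - eexists. apply strict_derive_ext_loc with (1 := Hh0).
      apply strict_derive_mult. apply strict_derive_id. exact Hg.
    - destruct (HFs z Hz) as [k Hk]. eexists.
      apply strict_derive_ext_loc with (1 := Hh1 z E).
      apply strict_derive_mult. apply strict_derive_id.
      apply strict_derive_mult. apply strict_derive_plus. exact Hk. apply strict_derive_const.
      now apply strict_derive_Cinv_shift. }
  assert (Hhc : forall z, filterlim h (locally z) (locally (h z))).
  { intros z. destruct (Req_dec_T (Cmod z) 1) as [E|E].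
    - assert (Hz : z <> z0) by (intros ->; contradiction).
      rewrite <- (locally_singleton _ _ (Hh1 z Hz)).
      refine (filterlim_ext_loc _ _ (Hh1 z Hz) _).
      apply filterlim_Cmult; try apply _. apply filterlim_id.
      apply filterlim_Cmult; try apply _. apply filterlim_Cplus; try apply _.
      apply HFc. apply filterlim_const.
      apply filterlim_Cinv; try apply _.
      intros E'. apply Hz. now apply Ceq_minus.
      apply filterlim_Cminus; try apply _. apply filterlim_id. apply filterlim_const.
    - destruct (Hhs z E) as [k Hk]. now apply strict_derive_continuous with k. }
  (* Here [z / (z - z0) = 1 + z0 / (z - z0)]; far enough out, [z] avoids both the circle and
     [z0]. *)
  assert (Hfar : C_infty (fun z => (f z - f z0) * (1 + z0 * / (z - z0)) = h z)).
  { exists (Rmax 1 (Cmod z0)). intros z Hz.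
    assert (M1 := Rmax_l 1 (Cmod z0)). assert (M2 := Rmax_r 1 (Cmod z0)).
    unfold h. destruct (Ceq_dec z z0) as [->|E]. exfalso; lra.
    rewrite <- (HFf z) by lra. rewrite <- (HFf z0) by exact Hz0.
    field. intros E'; apply E; now apply Ceq_minus. }
  assert (Hhl : filterlim h C_infty (locally (L - f z0))).
  { refine (filterlim_ext_loc _ _ Hfar _).
    replace (L - f z0) with ((L - f z0) * (1 + z0 * 0)) by ring.
    apply filterlim_Cmult; try apply _.
    - apply filterlim_Cminus; try apply _. exact HL. apply filterlim_const.
    - apply filterlim_Cplus; try apply _. apply filterlim_const.
      apply filterlim_Cmult; try apply _. apply filterlim_const. apply filterlim_Cinv_shift_infty. }
  assert (H := value_at_0_eq_limit h _ Hhc Hhs Hhl).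
  unfold h in H. rewrite Cmult_0_l in H. symmetry. apply Ceq_minus. now symmetry.
Qed.

(** * The Riemann-Hilbert problem *)

Lemma lt2_cases (i : nat) (P : nat -> Prop) : (i < 2)%nat -> P 0%nat -> P 1%nat -> P i.
Proof. intros Hi H0 H1. destruct i as [|[|i]]; [exact H0|exact H1|lia]. Qed.

Lemma mat2_ext (A B : mat2) :
  (forall i j, (i < 2)%nat -> (j < 2)%nat -> entry A i j = entry B i j) -> A = B.
Proof. intros H. now apply (coeff_mat_ext_aux (0 : C) (0 : C)). Qed.

Lemma entry_one2 (i j : nat) : (i < 2)%nat -> (j < 2)%nat ->
  entry one2 i j = if Nat.eqb i j then 1 else 0.
Proof. intros Hi Hj. now apply (lt2_cases i); [|apply (lt2_cases j)|apply (lt2_cases j)]. Qed.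

Lemma entry_mul2 (A B : mat2) (i j : nat) : (i < 2)%nat -> (j < 2)%nat ->
  entry (mul2 A B) i j = entry A i 0 * entry B 0 j + entry A i 1 * entry B 1 j.
Proof.
  intros Hi Hj. unfold entry, mul2, Mmult. rewrite coeff_mat_bij by assumption.
  simpl pred. rewrite sum_Sn, sum_O. reflexivity.
Qed.

(** The determinant with row [i] of [A] above row [k] of [B]. Row [i] of [A adj(B)] is
    [(row_wedge A B i 1, - row_wedge A B i 0)]. *)
Definition row_wedge (A B : mat2) (i k : nat) : C :=
  entry A i 0 * entry B k 1 - entry A i 1 * entry B k 0.

Definition det2 (A : mat2) : C := row_wedge A A 0 1.

Lemma row_wedge_mul2 (A B V : mat2) (i k : nat) : (i < 2)%nat -> (k < 2)%nat ->
  row_wedge (mul2 A V) (mul2 B V) i k = row_wedge A B i k * det2 V.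
Proof.
  intros Hi Hk. unfold det2, row_wedge. rewrite !entry_mul2 by (assumption || lia). ring.
Qed.

Lemma Cexp_opp_r (z : C) : Cexp z * Cexp (- z) = 1.
Proof.
  destruct z as [x y]. unfold Cexp, Copp, Cmult, Re, Im, RtoC. simpl.
  rewrite cos_neg, sin_neg.
  assert (E : (exp x * exp (- x) = 1)%R) by (rewrite <- exp_plus, Rplus_opp_r; apply exp_0).
  assert (S := sin2_cos2 y). unfold Rsqr in S.
  f_equal.
  - transitivity ((exp x * exp (- x)) * (sin y * sin y + cos y * cos y))%R. ring.
    rewrite E, S. ring.
  - ring.
Qed.

Lemma det2_exp_sigma3 (f : C) : det2 (exp_sigma3 f) = 1.
Proof.
  change (Cexp f * Cexp (- f) - 0 * 0 = 1). rewrite Cexp_opp_r. ring.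
Qed.

(** Both solutions are multiplied on the right by the same jump matrix of determinant 1, so their
    wedge has equal boundary values from the two sides and is constant by
    [liouville_across_circle]. *)
Lemma row_wedge_rhp_solutions (X T : R) (G : mat2) (P Q : C -> mat2) (z : C) (i k : nat) :
  det2 G = 1 -> rhp_solution X T G P -> rhp_solution X T G Q ->
  (i < 2)%nat -> (k < 2)%nat -> Cmod z <> 1%R ->
  row_wedge (P z) (Q z) i k = row_wedge one2 one2 i k.
Proof.
  intros HG [PA [[Pp [Pm [PBp [PBm PJ]]]] PL]] [QA [[Qp [Qm [QBp [QBm QJ]]]] QL]] Hi Hk Hz.
  assert (Hlim : forall (F : (C -> Prop) -> Prop) (FF : Filter F) (A B : C -> mat2) (A0 B0 : mat2),
    mat2_lim F A A0 -> mat2_lim F B B0 ->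
    filterlim (fun w => row_wedge (A w) (B w) i k) F (locally (row_wedge A0 B0 i k))).
  { intros F FF A B A0 B0 HA HB.
    apply filterlim_Cminus; try apply _; apply filterlim_Cmult; try apply _.
    - exact (HA i 0%nat Hi Nat.lt_0_2).
    - exact (HB k 1%nat Hk Nat.lt_1_2).
    - exact (HA i 1%nat Hi Nat.lt_1_2).
    - exact (HB k 0%nat Hk Nat.lt_0_2). }
  apply (liouville_across_circle (fun w => row_wedge (P w) (Q w) i k)
    (fun w => row_wedge (Pm w) (Qm w) i k)).
  - intros w Hw. unfold row_wedge.
    (* The difference is written as a sum with a factor -1, to which the closure lemmas for
       [regular_at] apply. *)
    assert (Hreg : regular_at (fun w => entry (P w) i 0 * entry (Q w) k 1
        + (- (1)) * (entry (P w) i 1 * entry (Q w) k 0)) w).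
    { apply regular_at_plus; [|apply regular_at_mult; [apply regular_at_const|]];
        apply regular_at_mult; apply analytic_at_regular.
      - exact (PA i 0%nat Hi Nat.lt_0_2 w Hw).
      - exact (QA k 1%nat Hk Nat.lt_1_2 w Hw).
      - exact (PA i 1%nat Hi Nat.lt_1_2 w Hw).
      - exact (QA k 0%nat Hk Nat.lt_0_2 w Hw). }
    destruct Hreg as [g [l [Hg E]]]. exists g, l. split. exact Hg.
    revert E. apply filter_imp. intros u E.
    transitivity (entry (P u) i 0 * entry (Q u) k 1 + (- (1)) * (entry (P u) i 1 * entry (Q u) k 0)).
    ring. rewrite E. ring.
  - intros w Hw. repeat split.
    + replace (row_wedge (Pm w) (Qm w) i k) with (row_wedge (Pp w) (Qp w) i k).
      apply Hlim. apply _. now apply PBp. now apply QBp.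
      rewrite PJ, QJ by exact Hw. rewrite !row_wedge_mul2 by assumption.
      rewrite HG, !det2_exp_sigma3. ring.
    + apply Hlim. apply _. now apply PBm. now apply QBm.
    + apply Hlim. apply _. now apply PBm. now apply QBm.
  - apply Hlim. apply _. exact PL. exact QL.
  - exact Hz.
Qed.

(** Let [p] be the first row of [P z] and [q], [r] the rows of [Q z]. The wedges of [p] with [q], of
    [p] with [r] and of [q] with [r] are 0, 1 and 1, so Cramer's rule in the basis [q], [r] gives
    [p = q]. *)
Lemma rhp_solution_unique_01 (X T : R) (G : mat2) (P Q : C -> mat2) (z : C) :
  det2 G = 1 -> rhp_solution X T G P -> rhp_solution X T G Q -> Cmod z <> 1%R ->
  entry (P z) 0 1 = entry (Q z) 0 1.
Proof.
  intros HG HP HQ Hz.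
  assert (W : forall A B, rhp_solution X T G A -> rhp_solution X T G B -> forall k, (k < 2)%nat ->
      row_wedge (A z) (B z) 0 k = row_wedge one2 one2 0 k).
  { intros A B HA HB k Hk. apply row_wedge_rhp_solutions with X T G; auto. }
  assert (E0 := W P Q HP HQ 0%nat ltac:(lia)). assert (E1 := W P Q HP HQ 1%nat ltac:(lia)).
  assert (F1 := W Q Q HQ HQ 1%nat ltac:(lia)).
  assert (I0 : row_wedge one2 one2 0 0 = 0) by (unfold row_wedge; ring).
  assert (I1 : row_wedge one2 one2 0 1 = 1).
  { unfold row_wedge. rewrite !entry_one2 by lia. simpl. ring. }
  rewrite I0 in E0. rewrite I1 in E1, F1. unfold row_wedge in *.
  set (p0 := entry (P z) 0 0) in *. set (p1 := entry (P z) 0 1) in *.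
  set (q0 := entry (Q z) 0 0) in *. set (q1 := entry (Q z) 0 1) in *.
  set (r0 := entry (Q z) 1 0) in *. set (r1 := entry (Q z) 1 1) in *.
  transitivity (p1 * (q0 * r1 - q1 * r0)). rewrite F1. ring.
  transitivity (q1 * (p0 * r1 - p1 * r0) - r1 * (p0 * q1 - p1 * q0)). ring.
  rewrite E0, E1. ring.
Qed.

(** * Diagonal scaling of solutions *)

Lemma analytic_at_scal (c : C) (f : C -> C) (z0 : C) :
  analytic_at f z0 -> analytic_at (fun z => c * f z) z0.
Proof.
  intros [a [r [Hr H]]]. exists (fun n => c * a n), r. split. exact Hr.
  intros z Hz. apply (@is_pseries_scal C_AbsRing C_NormedModule c a (z - z0) (f z)).
  apply Cmult_comm. now apply H.
Qed.

Lemma analytic_at_ext_loc (f g : C -> C) (z0 : C) :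
  locally z0 (fun z => f z = g z) -> analytic_at f z0 -> analytic_at g z0.
Proof.
  intros E [a [r [Hr H]]]. apply locally_Cmod in E. destruct E as [d [Hd E]].
  exists a, (Rmin d r). split. now apply Rmin_case.
  intros z Hz. rewrite <- E.
  - apply H. eapply Rlt_le_trans. exact Hz. apply Rmin_r.
  - eapply Rlt_le_trans. exact Hz. apply Rmin_l.
Qed.

(** For [c i j = p i * q j] this is [diag(p) A diag(q)]; in this form analyticity and limits pass
    through one entry at a time. *)
Definition scale_entries (c : nat -> nat -> C) (A : mat2) : mat2 :=
  mk_matrix 2 2 (fun i j => c i j * entry A i j).

Lemma entry_scale_entries (c : nat -> nat -> C) (A : mat2) (i j : nat) :
  (i < 2)%nat -> (j < 2)%nat -> entry (scale_entries c A) i j = c i j * entry A i j.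
Proof. exact (coeff_mat_bij (0 : C) (fun i j => c i j * entry A i j) i j). Qed.

Lemma mat2_lim_scale_entries (F : (C -> Prop) -> Prop) {FF : Filter F} (c : nat -> nat -> C)
  (A : C -> mat2) (A0 : mat2) :
  mat2_lim F A A0 -> mat2_lim F (fun z => scale_entries c (A z)) (scale_entries c A0).
Proof.
  intros H i j Hi Hj. rewrite entry_scale_entries by assumption.
  apply filterlim_ext with (f := fun z => c i j * entry (A z) i j).
  { intros z. now rewrite entry_scale_entries. }
  apply filterlim_Cmult; try apply _. apply filterlim_const. now apply H.
Qed.

Lemma mat2_lim_ext_loc (F : (C -> Prop) -> Prop) {FF : Filter F} (A B : C -> mat2) (A0 : mat2) :
  F (fun z => A z = B z) -> mat2_lim F A A0 -> mat2_lim F B A0.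
Proof.
  intros E H i j Hi Hj. refine (filterlim_ext_loc _ _ _ (H i j Hi Hj)).
  revert E. apply filter_imp. now intros z ->.
Qed.

(* For G = diag(u) H diag(v): the map P -> D P D^-1, P -> D P diag(u), with D = diag(v). *)
Definition rhp_conjugate (u v : nat -> C) (P : C -> mat2) (z : C) : mat2 :=
  if Rlt_dec (Cmod z) 1 then scale_entries (fun i j => v i * u j) (P z)
  else scale_entries (fun i j => v i / v j) (P z).

(** With [U = diag(u)], [D = diag(v)] and [E] the right exponential factor of the jump, [D (Pm E^-1
    U H D E) D^-1 = (D Pm U) E^-1 H E], because diagonal matrices commute. *)
Lemma rhp_solution_conjugate (X T : R) (G H : mat2) (u v : nat -> C) (P : C -> mat2) :
  (forall i, v i <> 0) ->
  (forall i j, (i < 2)%nat -> (j < 2)%nat -> entry G i j = u i * entry H i j * v j) ->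
  rhp_solution X T G P -> rhp_solution X T H (rhp_conjugate u v P).
Proof.
  intros Hv HG [PA [[Pp [Pm [PBp [PBm PJ]]]] PL]]. split; [|split].
  - intros i j Hi Hj z Hz.
    (* A point off the circle has a neighbourhood on one side of it, where a single constant scaling
       is in force. *)
    assert (Hloc : forall c, locally z (fun w => rhp_conjugate u v P w = scale_entries c (P w)) ->
        analytic_at (fun w => entry (rhp_conjugate u v P w) i j) z).
    { intros c Hc. apply analytic_at_ext_loc with (fun w => c i j * entry (P w) i j).
      - revert Hc. apply filter_imp. intros w ->. now rewrite entry_scale_entries.
      - apply analytic_at_scal. now apply PA. }
    destruct (Rlt_dec (Cmod z) 1) as [Hlt|Hge].
    + apply Hloc with (fun i j => v i * u j). apply locally_Cmod. exists (1 - Cmod z)%R. split. lra.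
      intros w Hw. unfold rhp_conjugate. destruct (Rlt_dec (Cmod w) 1) as [_|Hn]. reflexivity.
      assert (T2 := Cmod_triangle z (w - z)). replace (z + (w - z)) with w in T2 by ring. lra.
    + apply Hloc with (fun i j => v i / v j). apply locally_Cmod. exists (Cmod z - 1)%R. split. lra.
      intros w Hw. unfold rhp_conjugate. destruct (Rlt_dec (Cmod w) 1) as [Hn|_]. 2: reflexivity.
      assert (T2 := Cmod_triangle w (- (w - z))). replace (w + - (w - z)) with z in T2 by ring.
      rewrite Cmod_opp in T2. lra.
  - exists (fun z => scale_entries (fun i j => v i / v j) (Pp z)),
      (fun z => scale_entries (fun i j => v i * u j) (Pm z)). split; [|split].
    + intros z Hz. destruct (PBp z Hz) as [L1 L2]. split.
      * apply mat2_lim_ext_loc with (fun z => scale_entries (fun i j => v i / v j) (P z)). apply _.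
        { unfold within. apply filter_forall. intros w Hw. unfold exterior in Hw.
          unfold rhp_conjugate. destruct (Rlt_dec (Cmod w) 1); [lra|reflexivity]. }
        apply mat2_lim_scale_entries. apply _. exact L1.
      * apply mat2_lim_scale_entries. apply _. exact L2.
    + intros z Hz. destruct (PBm z Hz) as [L1 L2]. split.
      * apply mat2_lim_ext_loc with (fun z => scale_entries (fun i j => v i * u j) (P z)). apply _.
        { unfold within. apply filter_forall. intros w Hw. unfold Defs.interior in Hw.
          unfold rhp_conjugate. destruct (Rlt_dec (Cmod w) 1); [reflexivity|lra]. }
        apply mat2_lim_scale_entries. apply _. exact L1.
      * apply mat2_lim_scale_entries. apply _. exact L2.
    + intros z Hz. rewrite PJ by exact Hz. apply mat2_ext. intros i j Hi Hj.
      rewrite entry_scale_entries, !entry_mul2 by (assumption || lia).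
      rewrite !entry_scale_entries, !HG by (assumption || lia).
      (* The vanishing off-diagonal entries let the exponentials commute with the diagonal
         factors. *)
      assert (D : forall f, entry (exp_sigma3 f) 0 1 = 0 /\ entry (exp_sigma3 f) 1 0 = 0).
      { intros f. split; reflexivity. }
      destruct (D (- (Ci * phase X T z))) as [-> ->]. destruct (D (Ci * phase X T z)) as [D1 D2].
      apply (lt2_cases j); [exact Hj | rewrite D2 | rewrite D1]; field; auto.
  - apply mat2_lim_ext_loc with (fun z => scale_entries (fun i j => v i / v j) (P z)). apply _.
    { exists 1%R. intros w Hw. unfold rhp_conjugate. destruct (Rlt_dec (Cmod w) 1); [lra|reflexivity]. }
    (* Conjugation by a diagonal matrix fixes the identity, so the normalisation at infinity is
       kept. *)
    replace one2 with (scale_entries (fun i j => v i / v j) one2).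
    apply mat2_lim_scale_entries. apply _. exact PL.
    apply mat2_ext. intros i j Hi Hj. rewrite entry_scale_entries by assumption.
    rewrite entry_one2 by assumption. destruct (Nat.eqb_spec i j) as [->|E].
    + field. auto.
    + ring.
Qed.

(** * Chosen solutions and chosen limits *)

Lemma the_spec {A : Type} (d : A) (S : A -> Prop) : (exists x, S x) -> S (the d S).
Proof.
  intros H. unfold the. destruct (excluded_middle_informative _) as [H'|H']; [|contradiction].
  apply proj2_sig.
Qed.

Lemma the_default {A : Type} (d : A) (S : A -> Prop) : ~ (exists x, S x) -> the d S = d.
Proof. intros H. unfold the. now destruct (excluded_middle_informative _). Qed.

Lemma filterlim_C_unique {T : Type} (F : (T -> Prop) -> Prop) {FF : ProperFilter F}
  (f : T -> C) (l m : C) :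
  filterlim f F (locally l) -> filterlim f F (locally m) -> l = m.
Proof.
  apply (filterlim_locally_unique (K := R_AbsRing) (V := C_R_NormedModule)).
Qed.

(** As [c <> 0], the two limits exist together; if neither exists, both sides are the default 0. *)
Lemma lim_infty_scal (c : C) (f g : C -> C) :
  c <> 0 -> C_infty (fun z => f z = c * g z) -> lim_infty f = c * lim_infty g.
Proof.
  intros Hc E.
  assert (Hfg : forall l, filterlim g C_infty (locally l) -> filterlim f C_infty (locally (c * l))).
  { intros l Hl. apply filterlim_ext_loc with (fun z => c * g z).
    revert E. now apply filter_imp.
    apply filterlim_Cmult; try apply _. apply filterlim_const. exact Hl. }
  assert (Hgf : forall l, filterlim f C_infty (locally l) -> filterlim g C_infty (locally (/ c * l))).
  { intros l Hl. apply filterlim_ext_loc with (fun z => / c * f z).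
    revert E. apply filter_imp. intros z ->. field. exact Hc.
    apply filterlim_Cmult; try apply _. apply filterlim_const. exact Hl. }
  destruct (excluded_middle_informative (exists l : C, filterlim g C_infty (locally l))) as [Hg|Hg].
  - assert (Hf : exists l : C, filterlim f C_infty (locally l)).
    { destruct Hg as [l Hl]. exists (c * l). now apply Hfg. }
    apply (filterlim_C_unique C_infty f).
    + exact (the_spec (0 : C) _ Hf).
    + apply Hfg. exact (the_spec (0 : C) _ Hg).
  - unfold lim_infty. rewrite !the_default. ring. exact Hg.
    intros [l Hl]. apply Hg. exists (/ c * l). now apply Hgf.
Qed.

Lemma Cinv_neq_0 (z : C) : z <> 0 -> / z <> 0.
Proof. intros Hz E. apply C1_nz. rewrite <- (Cinv_l z Hz), E. ring. Qed.

Lemma Cdiv_neq_0 (x y : C) : x <> 0 -> y <> 0 -> x / y <> 0.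
Proof. intros Hx Hy. apply Cmult_neq_0. exact Hx. now apply Cinv_neq_0. Qed.

(** If one problem is solvable, so is the other, and uniqueness identifies the chosen solution for
    [H] with the conjugate of the one for [G] in the entry that matters. That entry is multiplied by
    [v 0 / v 1] outside the circle, whence the inverse factor here. *)
Lemma Psi_conjugate (X T : R) (G H : mat2) (u v : nat -> C) :
  det2 H = 1 -> (forall i, u i <> 0) -> (forall i, v i <> 0) ->
  (forall i j, (i < 2)%nat -> (j < 2)%nat -> entry G i j = u i * entry H i j * v j) ->
  Psi X T G = v 1%nat / v 0%nat * Psi X T H.
Proof.
  intros HH Hu Hv E. unfold Psi.
  rewrite (lim_infty_scal (v 1%nat / v 0%nat) (fun z => z * entry (Psol X T G z) 0 1)
    (fun z => z * entry (Psol X T H z) 0 1)).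
  - ring.
  - apply Cdiv_neq_0; apply Hv.
  - exists 1%R. intros z Hz.
    destruct (excluded_middle_informative (exists P, rhp_solution X T G P)) as [[P HP]|HG].
    + assert (SG : rhp_solution X T G (Psol X T G)) by exact (the_spec _ (rhp_solution X T G) (ex_intro _ P HP)).
      assert (SC := rhp_solution_conjugate X T G H u v _ Hv E SG).
      assert (SH : rhp_solution X T H (Psol X T H)) by exact (the_spec _ (rhp_solution X T H) (ex_intro _ _ SC)).
      rewrite (rhp_solution_unique_01 X T H _ _ z HH SH SC) by lra.
      unfold rhp_conjugate. destruct (Rlt_dec (Cmod z) 1). lra.
      rewrite entry_scale_entries by lia. field. auto.
    (* The relation is reversed by [1 / u] and [1 / v], so unsolvability for [G] passes to [H]; then
       both chosen functions are the zero default. *)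
    + assert (HN : ~ exists P, rhp_solution X T H P).
      { intros [P HP]. apply HG. eexists.
        apply (rhp_solution_conjugate X T H G (fun i => / u i) (fun i => / v i) P).
        - intros i. now apply Cinv_neq_0.
        - intros i j Hi Hj. rewrite E by assumption. field. auto.
        - exact HP. }
      unfold Psol. rewrite !the_default by assumption.
      change (z * 0 = v 1%nat / v 0%nat * (z * 0)). ring.
Qed.

(** The argument has cosine [Re z / |z|] and sine [Im z / |z|], so the exponential is the conjugate
    of [z] divided by [|z|], which equals [|z| / z]. *)
Lemma Cexp_Carg (z : C) : z <> 0 -> Cexp (- (Ci * Carg z)) = Cmod z / z.
Proof.
  intros Hz. assert (Hm := proj1 (Cmod_gt_0 z) Hz).
  assert (H2 := Cmod2_alt z).
  set (m := Cmod z) in *. set (q := (Re z / m)%R).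
  assert (Hq : (-1 <= q <= 1)%R).
  { assert (H := re_le_Cmod z). fold m in H. apply Rabs_le_between in H. unfold q. split.
    - apply Rmult_le_reg_r with m. exact Hm. unfold Rdiv. rewrite Rmult_assoc, Rinv_l by lra. lra.
    - apply Rmult_le_reg_r with m. exact Hm. unfold Rdiv. rewrite Rmult_assoc, Rinv_l by lra. lra. }
  (* The sine is nonnegative on the range of [acos], hence the absolute value; the two cases of
     [Carg] restore the sign. *)
  assert (Hs : sin (acos q) = (Rabs (Im z) / m)%R).
  { rewrite sin_acos by exact Hq. replace (1 - q²)%R with ((Im z / m)²)%R.
    - rewrite sqrt_Rsqr_abs. unfold Rdiv. rewrite Rabs_mult, (Rabs_pos_eq (/ m)). reflexivity.
      apply Rlt_le, Rinv_0_lt_compat, Hm.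
    - unfold q, Rsqr. apply Rmult_eq_reg_r with (m ^ 2)%R. 2: apply pow_nonzero; lra.
      replace (Im z / m * (Im z / m) * m ^ 2)%R with (Im z ^ 2)%R by (field; lra).
      replace ((1 - Re z / m * (Re z / m)) * m ^ 2)%R with (m ^ 2 - Re z ^ 2)%R by (field; lra).
      lra. }
  assert (HC : cos (Carg z) = (Re z / m)%R /\ sin (Carg z) = (Im z / m)%R).
  { unfold Carg. fold m. fold q. destruct (Rle_dec 0 (Im z)) as [Hi|Hi].
    - rewrite cos_acos, Hs by exact Hq. rewrite Rabs_pos_eq by exact Hi. now split.
    - rewrite cos_neg, sin_neg, cos_acos, Hs by exact Hq. rewrite Rabs_left by lra.
      split. reflexivity. field. lra. }
  destruct HC as [HC HS].
  replace (Cexp (- (Ci * Carg z))) with ((cos (Carg z), (- sin (Carg z))%R) : C).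
  - rewrite HC, HS.
    assert (E : (((Re z / m)%R, (- (Im z / m))%R) : C) * z = m).
    2: { rewrite <- E. unfold Cdiv. rewrite <- Cmult_assoc, Cinv_r, Cmult_1_r by exact Hz. reflexivity. }
    destruct z as [x y]. unfold Re, Im in *. simpl fst in *. simpl snd in *.
    unfold Cmult, RtoC. simpl fst. simpl snd. f_equal.
    + apply Rmult_eq_reg_r with m. 2: lra.
      replace ((x / m * x - - (y / m) * y) * m)%R with (x ^ 2 + y ^ 2)%R by (field; lra).
      rewrite <- H2. ring.
    + field. lra.
  - unfold Cexp, Ci, Cmult, Copp, RtoC, Re, Im. simpl.
    replace (- (0 * Carg z - 1 * 0))%R with 0%R by ring.
    replace (- (0 * 0 + 1 * Carg z))%R with (- Carg z)%R by ring.
    rewrite exp_0, cos_neg, sin_neg. f_equal; ring.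
Qed.

Theorem proposition1p5 (X T : R) (a b : C) (hab : a * b <> 0) :
  let fa : R := (Cmod a / sqrt (Cmod a ^ 2 + Cmod b ^ 2))%R in
  let fb : R := (Cmod b / sqrt (Cmod a ^ 2 + Cmod b ^ 2))%R in
  ((0 < fa)%R /\ (0 < fb)%R /\ (fa ^ 2 + fb ^ 2 = 1)%R) /\
  Psi X T (Gmat a b) =
    Cexp (- (Ci * Carg (a * b))) * Psi X T (Gmat fa fb).
Proof.
  assert (Ha : a <> 0) by (intros ->; apply hab; ring).
  assert (Hb : b <> 0) by (intros ->; apply hab; ring).
  assert (Ma := proj1 (Cmod_gt_0 a) Ha). assert (Mb := proj1 (Cmod_gt_0 b) Hb).
  assert (HN2 : (0 < Cmod a ^ 2 + Cmod b ^ 2)%R).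
  { apply Rplus_lt_0_compat; apply pow_lt; assumption. }
  assert (HN := sqrt_lt_R0 _ HN2). assert (HNN := pow2_sqrt _ (Rlt_le _ _ HN2)).
  intros fa fb.
  assert (Hfa : (0 < fa)%R) by (apply Rdiv_lt_0_compat; assumption).
  assert (Hfb : (0 < fb)%R) by (apply Rdiv_lt_0_compat; assumption).
  assert (Hf : (fa ^ 2 + fb ^ 2 = 1)%R).
  { unfold fa, fb. set (N := sqrt _) in *.
    replace ((Cmod a / N) ^ 2 + (Cmod b / N) ^ 2)%R with ((Cmod a ^ 2 + Cmod b ^ 2) / N ^ 2)%R
      by (field; lra).
    rewrite HNN. field. lra. }
  split. now repeat split.
  rewrite Cexp_Carg by exact hab. rewrite Cmod_mult, RtoC_mult.
  assert (Ra : RtoC (Cmod a) <> 0) by (intros E; apply RtoC_inj in E; lra).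
  assert (Rb : RtoC (Cmod b) <> 0) by (intros E; apply RtoC_inj in E; lra).
  assert (RN : RtoC (sqrt (Cmod a ^ 2 + Cmod b ^ 2)) <> 0) by (intros E; apply RtoC_inj in E; lra).
  (* The normalising factor is 1 because [fa ^ 2 + fb ^ 2 = 1]. *)
  assert (HG : Gmat fa fb = [[RtoC fa, RtoC fb], [- RtoC fb, RtoC fa]]).
  { unfold Gmat. rewrite !Cmod_R, !Rabs_pos_eq by lra. rewrite Hf, sqrt_1.
    assert (Hc : forall r : R, Cconj (RtoC r) = RtoC r).
    { intros r. unfold Cconj, RtoC. simpl. f_equal. ring. }
    rewrite !Hc. repeat f_equal; field; apply C1_nz. }
  (* Conjugates become quotients, so that the entries can be compared as rational expressions. *)
  assert (Ca : Cconj a = Cmod a * Cmod a / a).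
  { rewrite <- RtoC_mult. replace (Cmod a * Cmod a)%R with (Cmod a ^ 2)%R by ring.
    rewrite Cmod2_conj. field. exact Ha. }
  assert (Cb : Cconj b = Cmod b * Cmod b / b).
  { rewrite <- RtoC_mult. replace (Cmod b * Cmod b)%R with (Cmod b ^ 2)%R by ring.
    rewrite Cmod2_conj. field. exact Hb. }
  (* With [alpha], [beta] the phases of [a], [b], these are the diagonals [(1/beta, 1/alpha)] and
     [(alpha beta, 1)]; thus [v 1 / v 0 = |a b| / (a b)], the required phase factor. *)
  pose (u := fun i : nat => match i with O => Cmod b / b | _ => Cmod a / a end).
  pose (v := fun i : nat => match i with O => a * b / (Cmod a * Cmod b) | _ => 1 end).
  rewrite (Psi_conjugate X T (Gmat a b) (Gmat fa fb) u v).
  - unfold u, v. f_equal. field. repeat split; assumption.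
  - rewrite HG. change (RtoC fa * RtoC fa - RtoC fb * (- RtoC fb) = 1).
    transitivity (RtoC (fa ^ 2 + fb ^ 2)). rewrite RtoC_plus, !RtoC_pow. ring. now rewrite Hf.
  - intros [|i]; now apply Cdiv_neq_0.
  - intros [|i]. apply Cdiv_neq_0. exact hab. now apply Cmult_neq_0. apply C1_nz.
  - rewrite HG. unfold Gmat, fa, fb. rewrite !RtoC_div, Ca, Cb by lra.
    intros i j Hi Hj.
    apply (lt2_cases i); [exact Hi| |]; apply (lt2_cases j); try exact Hj;
      unfold entry, coeff_mat, u, v; simpl; field; repeat split; assumption.
Qed.
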